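(* Let $1\le r\le n-1$ and $t=n-r$, and consider the level-$r$ strategy operator for the target state $|\mathrm{GHZ}_n\rangle=\frac1{\sqrt2}(|0\rangle^{\otimes n}+|1\rangle^{\otimes n})$ in two cases: (i) uniform sampling over all symplectic vectors $\mu\in\mathbb Z_2^{2n}$ of weight $t$; (ii) uniform sampling over all permutation-equivalence classes $[\mu]$ of symplectic vectors of weight $t$. In both cases the second-largest eigenvalue of the strategy operator $\Omega$ corresponds to the eigenvector $|\mathcal S_{(1,\boldsymbol 0^{n-1})}\rangle$ in the stabilizer basis of $|\mathrm{GHZ}_n\rangle$. The second-largest eigenvalues in the cases (i), (ii) are $1-(2/3)^{n-r}$ and $(n-r)/(n-r+2)$ respectively, and hence the spectral gaps are $$\left(\frac23\right)^{n-r},\qquad \frac{2}{n-r+2}$$ respectively.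
   Context: A vector $\mu=(\mu^{\mathrm x};\mu^{\mathrm z})\in\mathbb Z_2^{2n}$ specifies a composite Pauli measurement: on qubit $j$ one measures $X$, $Z$, $Y$ if $(\mu_j^{\mathrm x};\mu_j^{\mathrm z})=(1;0),(0;1),(1;1)$ respectively, and nothing if it is $(0;0)$. Its weight is the number of qubits on which a measurement is made; $(\mathbb Z_2^{2n})_t$ is the set of $\mu$ of weight $t$ (there are $\binom nt3^t$). For $\mu$ of weight $t$ let $J=\{j_1,\dots,j_t\}$ be the measured qubits, $P_{j_a}$ the Pauli operator measured on qubit $j_a$, and for $\boldsymbol v\in\mathbb Z_2^t$ let $\Pi_{\mu,\boldsymbol v}=\bigotimes_{a=1}^t\frac12[I+(-1)^{v_a}P_{j_a}]$ (acting on $J$). With $\rho=|\mathrm{GHZ}_n\rangle\langle\mathrm{GHZ}_n|$ the test operator is $$\Omega_\mu=\sum_{\boldsymbol v\in\mathbb Z_2^t}\Pi_{\mu,\boldsymbol v}\otimes\frac{\mathrm{Tr}_J(\rho\,\Pi_{\mu,\boldsymbol v})}{\mathrm{Tr}(\rho\,\Pi_{\mu,\boldsymbol v})},$$ where terms with $\mathrm{Tr}(\rho\Pi_{\mu,\boldsymbol v})=0$ are omitted. Two vectors $\mu,\mu'$ are equivalent if they are related by a permutation of the $n$ qubits; classes $[\mu]$ of weight $t$ are labelled by the numbers $(m_x,m_y,m_z)$ of $X$, $Y$, $Z$ measurements, $m_x+m_y+m_z=t$ (there are $\binom{t+2}{2}$ classes). Strategy operators: case (i) $\Omega=\frac{1}{\binom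 nt3^t}\sum_{\mu\in(\mathbb Z_2^{2n})_t}\Omega_\mu$; case (ii) $\Omega=\frac{2}{(t+1)(t+2)}\sum_{[\mu]}\frac1{|[\mu]|}\sum_{\mu\in[\mu]}\Omega_\mu$. The stabilizer group of $|\mathrm{GHZ}_n\rangle$ is generated by $g_1=X^{\otimes n}$ and $g_a=Z_1Z_a$ for $2\le a\le n$. For $\boldsymbol w\in\mathbb Z_2^n$, $|\mathcal S_{\boldsymbol w}\rangle$ is the (unique up to phase) unit vector with $g_i|\mathcal S_{\boldsymbol w}\rangle=(-1)^{w_i}|\mathcal S_{\boldsymbol w}\rangle$ for all $i$; these $2^n$ vectors form the stabilizer basis, and $|\mathcal S_{\boldsymbol 0}\rangle=|\mathrm{GHZ}_n\rangle$ is an eigenvector of $\Omega$ with eigenvalue $1$, the largest one. $(1,\boldsymbol 0^{n-1})$ is the vector with $w_1=1$ and all other entries $0$. The eigenvalues are ordered with multiplicity $\lambda_1=1\ge\lambda_2\ge\cdots$, and the spectral gap is $1-\lambda_2$. *)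

(* Defs.v *)
From HB Require Import structures.
From mathcomp Require Import all_boot all_order all_algebra perm.
From mathcomp Require Import complex.
From mathcomp Require Import reals.

Set Implicit Arguments.
Unset Strict Implicit.
Unset Printing Implicit Defensive.

Import Order.TTheory GRing.Theory Num.Theory.

Open Scope ring_scope.
Open Scope sesquilinear_scope.

(* Qubits are labelled by an arbitrary finite type Q; the computational basis
   states of the register Q are the functions Q -> Z_2, transported to matrix
   indices by enum_rank / enum_val.  For Q = 'I_n the dimension
   #|bits 'I_n| is 2 ^ n. *)
Notation bits Q := {ffun Q -> 'Z_2}.
Notation qvec C Q := 'cV[C]_#|{: bits Q}|.
Notation qop C Q := 'M[C]_#|{: bits Q}|.

Section Register.
Variables (C : numClosedFieldType) (Q : finType).

Definition ket (x : bits Q) : qvec C Q := delta_mx (enum_rank x) 0.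

Definition qentry (A : qop C Q) (x y : bits Q) : C :=
  A (enum_rank x) (enum_rank y).

Definition mkqop (f : bits Q -> bits Q -> C) : qop C Q :=
  \matrix_(a, b) f (enum_val a) (enum_val b).

Definition tens (A : Q -> 'M[C]_2) : qop C Q :=
  mkqop (fun x y => \prod_j A j (x j) (y j)).

End Register.

Section Subregister.
Variables (C : numClosedFieldType) (Q : finType).

Definition subreg (J : {set Q}) := {j : Q | j \in J}.

Definition restr (J : {set Q}) (x : bits Q) : bits (subreg J) :=
  [ffun j => x (val j)].

Definition otimes (J : {set Q})
    (A : qop C (subreg J)) (B : qop C (subreg (~: J))) : qop C Q :=
  mkqop (fun x y => qentry A (restr J x) (restr J y) *
                    qentry B (restr (~: J) x) (restr (~: J) y)).

(* <a| Tr_J(A) |b> = \sum_c <c a| A |c b>, where the pairs (c a, c b) are the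
   basis states x, y that agree on J and restrict to a, b off J. *)
Definition ptrace (J : {set Q}) (A : qop C Q) : qop C (subreg (~: J)) :=
  mkqop (fun a b =>
    \sum_(x : bits Q | restr (~: J) x == a)
      \sum_(y : bits Q | (restr (~: J) y == b) && (restr J y == restr J x))
        qentry A x y).

End Subregister.

Section Pauli.
Variable C : numClosedFieldType.

Definition pauliX : 'M[C]_2 := \matrix_(i, j) (i != j)%:R.
Definition pauliY : 'M[C]_2 :=
  \matrix_(i, j) if i == j then 0 else if i == 0 then - 'i else 'i.
Definition pauliZ : 'M[C]_2 := \matrix_(i, j) if i == j then (-1) ^+ i else 0.

(* The pair (0, 0) means that the qubit is not measured. *)
Definition pauli (a b : 'Z_2) : 'M[C]_2 :=
  if a == 1 then (if b == 1 then pauliY else pauliX)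
  else (if b == 1 then pauliZ else 1%:M).

End Pauli.

(* Vectors (mu^x ; mu^z) in Z_2^(2n). *)
Notation symp n := 'rV['Z_2]_(n + n).

Section Symplectic.
Variable n : nat.

Definition mux (mu : symp n) (j : 'I_n) : 'Z_2 := lsubmx mu 0 j.
Definition muz (mu : symp n) (j : 'I_n) : 'Z_2 := rsubmx mu 0 j.

Definition measured (mu : symp n) : {set 'I_n} :=
  [set j | (mux mu j, muz mu j) != (0, 0)].

Definition weight (mu : symp n) : nat := #|measured mu|.

Definition symp_wt (t : nat) : {set symp n} := [set mu | weight mu == t].

Definition qubit_perm (s : 'S_n) (mu : symp n) : symp n :=
  row_mx (col_perm s (lsubmx mu)) (col_perm s (rsubmx mu)).

Definition symp_class (mu : symp n) : {set symp n} :=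
  [set qubit_perm s mu | s : 'S_n].

Definition symp_classes (t : nat) : {set {set symp n}} :=
  [set symp_class mu | mu in symp_wt t].

End Symplectic.

Section Verification.
Variables (C : numClosedFieldType) (n : nat).

Definition ghz : qvec C 'I_n :=
  (sqrtC 2)^-1 *: (ket C [ffun => 0] + ket C [ffun => 1]).

Definition rho : qop C 'I_n := ghz *m ghz ^t*.

(* Outcome strings v in Z_2^t are indexed by the t measured qubits. *)
Definition proj (mu : symp n) (v : bits (subreg (measured mu))) :
    qop C (subreg (measured mu)) :=
  tens (fun j : subreg (measured mu) =>
    2^-1 *: (1%:M + (-1) ^+ v j *: pauli C (mux mu (val j)) (muz mu (val j)))).

Definition rho_proj (mu : symp n) (v : bits (subreg (measured mu))) :
    qop C 'I_n :=
  rho *m otimes (proj v) 1%:M.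

Definition test_op (mu : symp n) : qop C 'I_n :=
  \sum_(v : bits (subreg (measured mu)) | \tr (rho_proj v) != 0)
    otimes (proj v)
      ((\tr (rho_proj v))^-1 *: ptrace (measured mu) (rho_proj v)).

Definition strategy_uniform (t : nat) : qop C 'I_n :=
  ('C(n, t) * 3 ^ t)%:R^-1 *: \sum_(mu in symp_wt n t) test_op mu.

Definition strategy_classes (t : nat) : qop C 'I_n :=
  (2 / ((t + 1) * (t + 2))%:R) *:
    \sum_(c in symp_classes n t) #|c|%:R^-1 *: \sum_(mu in c) test_op mu.

(* Qubits are numbered from 0, so i = 0 gives g_1 = X^{(x) n} and i = a - 1
   gives g_a = Z_1 Z_a. *)
Definition ghz_gen (i : 'I_n) : qop C 'I_n :=
  if i == 0 :> nat then tens (fun=> pauliX C)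
  else tens (fun j : 'I_n =>
    if (j == 0 :> nat) || (j == i) then pauliZ C else 1%:M).

Definition is_stabilizer_state (w : 'rV['Z_2]_n) (psi : qvec C 'I_n) : Prop :=
  psi ^t* *m psi = 1%:M /\
  forall i, ghz_gen i *m psi = (-1) ^+ w 0 i *: psi.

(* (1, 0, ..., 0) *)
Definition w10 : 'rV['Z_2]_n := \row_j (j == 0 :> nat)%:R.

End Verification.

Section Existence.
Variables (C : numClosedFieldType).

Lemma sum_bits (Q : finType) (F : 'I_#|{: bits Q}| -> C) :
  \sum_a F a = \sum_(x : bits Q) F (enum_rank x).
Proof.
rewrite (reindex (@enum_rank {: bits Q})) //=.
by exists enum_val => x _; rewrite ?enum_rankK ?enum_valK.
Qed.

Lemma tens_mulE (Q : finType) (A : Q -> 'M[C]_2) (psi : qvec C Q) x :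
  (tens A *m psi) (enum_rank x) 0 =
  \sum_(y : bits Q) (\prod_j A j (x j) (y j)) * psi (enum_rank y) 0.
Proof. by rewrite mxE sum_bits; apply: eq_bigr => y _; rewrite mxE !enum_rankK. Qed.

Lemma Z2_neq (a b : 'Z_2) : (a != b) = (b == a + 1).
Proof. by case: a b => [[|[|?]] ?] [[|[|?]] ?]. Qed.

Lemma signZ2 (a b : 'Z_2) : (-1) ^+ (a + b)%R = (-1) ^+ a * (-1) ^+ b :> C.
Proof.
by case: a b => [[|[|?]] ?] [[|[|?]] ?] //=;
  rewrite /= ?expr0 ?expr1 ?mulr1 ?mul1r ?mulrNN ?mulr1.
Qed.

Lemma stabilizer_state_exists n (w : 'rV['Z_2]_n) : (0 < n)%N ->
  exists psi : qvec C 'I_n, is_stabilizer_state w psi.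
Proof.
case: n w => // n w _.
pose b : bits 'I_n.+1 := [ffun j => if j == 0 then 0 else w 0 j].
pose flip (x : bits 'I_n.+1) : bits 'I_n.+1 := [ffun j => x j + 1].
have flipK : involutive flip.
  by move=> x; apply/ffunP=> j; rewrite !ffunE -addrA; case: (x j) => [[|[|?]] ?]; apply/val_inj.
have bF : (b == flip b) = false.
  by apply/negP=> /eqP/ffunP/(_ 0); rewrite !ffunE eqxx.
pose f (x : bits 'I_n.+1) : C :=
  (sqrtC 2)^-1 * ((x == b)%:R + (-1) ^+ w 0 0 * (x == flip b)%:R).
pose psi : qvec C 'I_n.+1 := \col_a f (enum_val a).
have psiE x : psi (enum_rank x) 0 = f x by rewrite mxE enum_rankK.
have extc (u v : qvec C 'I_n.+1) :
    (forall x, u (enum_rank x) 0 = v (enum_rank x) 0) -> u = v.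
  by move=> uv; apply/matrixP=> i j; rewrite ord1 -(enum_valK i).
exists psi; split.
  apply/matrixP=> i j; rewrite !ord1 mxE sum_bits (bigD1 b) //=.
  rewrite (bigD1 (flip b)) /=; last by rewrite eq_sym bF.
  rewrite big1 => [|x /andP[/negPf xb /negPf xf]].
    rewrite !mxE !enum_rankK /f !eqxx bF eq_sym bF !mulr0 !mulr1 !addr0 add0r.
    have r2 : (sqrtC 2)^-1 \is @Num.real C by rewrite realV ger0_real // sqrtC_ge0.
    rewrite (CrealP (realM r2 (realX _ (rpredN1 _)))) mulr1 (CrealP r2).
    rewrite mulrACA -exprMn mulrNN mulr1 expr1n mulr1.
    by rewrite -expr2 exprVn sqrtCK /= -[2^-1]mul1r -splitr.
  by rewrite !mxE enum_rankK /f xb xf mulr0 addr0 mulr0 mulr0.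
move=> i; apply: extc => x; rewrite [RHS]mxE psiE /ghz_gen.
have [i0|i0] := eqVneq (i : nat) 0%N.
  have -> : i = 0 by apply: val_inj.
  rewrite tens_mulE (bigD1 (flip x)) //= [X in _ + X]big1 ?addr0.
    rewrite big1 => [|j _]; last by rewrite mxE ffunE Z2_neq eqxx.
    rewrite psiE mul1r /f (can2_eq flipK flipK) (inj_eq (inv_inj flipK)).
    have ss : (-1) ^+ w 0 0 * (-1) ^+ w 0 0 = 1 :> C.
      by rewrite -exprMn mulrNN mulr1 expr1n.
    by rewrite [RHS]mulrCA [in RHS]mulrDr [in RHS]mulrA ss mul1r [in RHS]addrC.
  move=> y yx; have [j yj|H] := pickP (fun j => y j != flip x j); last first.
    by case/eqP: yx; apply/ffunP=> j; apply/eqP; have := H j; case: eqP.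
  rewrite (bigD1 j) //= mxE Z2_neq.
  by move: yj; rewrite ffunE => /negPf ->; rewrite !mul0r.
rewrite tens_mulE (bigD1 x) //= [X in _ + X]big1 ?addr0; last first.
  move=> y yx; have [j yj|H] := pickP (fun j => y j != x j); last first.
    by case/eqP: yx; apply/ffunP=> j; apply/eqP; have := H j; case: eqP.
  rewrite (bigD1 j) //=.
  by case: ifP => _; rewrite mxE eq_sym (negPf yj) !mul0r.
rewrite psiE.
have -> : \prod_(j < n.+1) (if (j == 0 :> nat) || (j == i) then pauliZ C else 1%:M)
     (x j) (x j) = (-1) ^+ x 0 * (-1) ^+ x i :> C.
  rewrite (bigD1 0) //= (bigD1 i) //= big1 => [|j /andP[j0 ji]].
    by rewrite eqxx orbT !mxE !eqxx mulr1.
  by rewrite -(inj_eq val_inj) /= in j0; rewrite (negPf j0) (negPf ji) mxE eqxx.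
rewrite -signZ2 /f.
have i0' : (i == 0) = false by apply/negP=> /eqP ii; rewrite ii in i0.
have [->|xb] := eqVneq x b; first by rewrite !ffunE eqxx i0' add0r.
have [->|xf] := eqVneq x (flip b).
  rewrite !ffunE eqxx i0' add0r; congr (_ ^+ _ * _).
  by case: (w 0 i) => [[|[|?]] ?].
by rewrite mulr0 addr0 !mulr0.
Qed.
End Existence.

(* s lists the eigenvalues of A, all real, with (algebraic) multiplicity and in
   nonincreasing order; s is determined by A. *)
Definition ordered_spectrum (R : realType) m (A : 'M[R[i]]_m) (s : seq R) :=
  char_poly A = \prod_(a <- s) ('X - (a%:C%C)%:P) /\ sorted >=%R s.

(* Main.v *)
Require Import Defs.
From HB Require Import structures.
From mathcomp Require Import all_boot all_order all_algebra perm.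
From mathcomp Require Import complex.
From mathcomp Require Import reals.
From mathcomp Require Import ring lra zify.

(** For a measurement [mu] with unmeasured set U, Z-measured set Z and
    Y-measured set Y, the operator Omega_mu only connects a basis state x with
    itself and with its complement x + 1.  It is diagonal when Z is nonempty
    (the projector onto the x that are constant on U and Z), and otherwise it
    is half of (1 + sign * complement) on the x that are equal to a constant a
    on U, the sign being (-1)^#{j in Y : x_j <> a}.  Hence every strategy
    operator is diagonalized by the vectors |x> +- |x + 1>, and the eigenvalue
    is a sum over the sets M of measured qubits and the labelings of M by X, Y
    and Z.  For x = 0 and the sign - only the labelings with a Z contribute.
    If x differs from a exactly on a nonempty D \subset M, fix j in D:
    the labelings with j in Z contribute 0, and they form one third of the
    total weight by the symmetry of the three labels; it remains to see that
    the labelings without Z and with a fixed parity of #|Y :&: D| weigh at most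
    one third.  In case (ii) the number of Y given that no Z occurs is uniform,
    which is consistent under restriction to D, so the mean of (-1)^#|Y :&: D|
    is 1 / (#|D| + 1) or 0 according to the parity of #|D|. *)

Set Implicit Arguments.
Unset Strict Implicit.
Unset Printing Implicit Defensive.

Import Order.TTheory GRing.Theory Num.Theory.

Local Open Scope ring_scope.

(** * Weighted sums over labelings *)

Section SubsetSums.
Variables (V : nmodType) (T : finType).
Implicit Types (A B : {set T}).

Lemma sum_subsetU1 (j : T) A (F : {set T} -> V) : j \notin A ->
  \sum_(B : {set T} | B \subset j |: A) F B =
  \sum_(B : {set T} | B \subset A) (F B + F (j |: B)).
Proof.
move=> jA; rewrite big_split /= (bigID (fun B : {set T} => j \in B)) /= addrC.
congr (_ + _).
  apply: eq_bigl => B; apply/andP/idP => [[BA jB]|BA].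
    by rewrite -(setU1K jA) subsetD1 BA.
  by rewrite (subset_trans BA) ?subsetU1 //; split=> //; apply: contra jA; apply: (subsetP BA).
rewrite (reindex_onto (fun B => j |: B) (fun B => B :\ j)) /=; last first.
  by move=> B /andP[_ jB]; rewrite setD1K.
apply: eq_bigl => B; apply/andP/idP => [[/andP[BA _] /eqP BE]|BA].
  by rewrite -BE -(setU1K jA) setSD.
have jB : j \notin B by apply: contra jA; apply: (subsetP BA).
by rewrite setU1K // eqxx setUS // setU11.
Qed.

Lemma sum_subset_card A (F : nat -> V) :
  \sum_(B : {set T} | B \subset A) F #|B| =
  \sum_(k < #|A|.+1) F k *+ 'C(#|A|, k).
Proof.
have cardB (B : {set T}) : B \subset A -> (#|B| < #|A|.+1)%N.
  by move=> BA; rewrite ltnS subset_leq_card.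
rewrite (partition_big (fun B => inord #|B| : 'I_#|A|.+1) xpredT) //=.
apply: eq_bigr => k _; rewrite -cards_draws -sumr_const.
apply: eq_big => [B|B /andP[BA /eqP <-]]; last by rewrite inordK ?cardB.
rewrite inE; have [BA|//] := boolP (B \subset A).
by rewrite -(inj_eq val_inj) /= inordK ?cardB.
Qed.

End SubsetSums.

(** * Reciprocal binomial weights on subsets, as in a Pólya urn *)

Section Polya.
Variables (R : realFieldType) (T : finType).
Implicit Types (A B D M Y Z : {set T}).

(** Over the common denominator (m+1) C(m,k) the two reciprocals have numerators m+1-k and k+1,
    which add up to m+2. This is the restriction property below for the removal of one element. *)
Lemma invr_bin_addn (m k : nat) : (k <= m)%N ->
  ('C(m.+1, k)%:R^-1 + 'C(m.+1, k.+1)%:R^-1) / m.+2%:R =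
  'C(m, k)%:R^-1 / m.+1%:R :> R.
Proof.
move=> km.
have h1 : m.+1%:R * 'C(m, k)%:R = (m.+1 - k)%:R * 'C(m.+1, k)%:R :> R.
  by rewrite -!natrM mul_bin_down.
have h2 : m.+1%:R * 'C(m, k)%:R = k.+1%:R * 'C(m.+1, k.+1)%:R :> R.
  by rewrite -!natrM mul_bin_diag.
have c0 : 'C(m, k)%:R != 0 :> R by rewrite pnatr_eq0 -lt0n bin_gt0.
have c1 : 'C(m.+1, k)%:R != 0 :> R by rewrite pnatr_eq0 -lt0n bin_gt0 leqW.
have c2 : 'C(m.+1, k.+1)%:R != 0 :> R by rewrite pnatr_eq0 -lt0n bin_gt0 ltnS.
have m1 : m.+1%:R != 0 :> R by rewrite pnatr_eq0.
have m2 : m.+2%:R != 0 :> R by rewrite pnatr_eq0.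
have k1 : k.+1%:R != 0 :> R by rewrite pnatr_eq0.
have mk : (m.+1 - k)%:R != 0 :> R by rewrite pnatr_eq0 subn_eq0 -ltnNge ltnS.
have -> : 'C(m.+1, k)%:R^-1 = (m.+1 - k)%:R / (m.+1%:R * 'C(m, k)%:R) :> R.
  by rewrite h1 invfM mulrA mulfV // mul1r.
have -> : 'C(m.+1, k.+1)%:R^-1 = k.+1%:R / (m.+1%:R * 'C(m, k)%:R) :> R.
  by rewrite h2 invfM mulrA mulfV // mul1r.
rewrite -mulrDl -natrD (_ : m.+1 - k + k.+1 = m.+2)%N; last by lia.
by rewrite mulrAC mulfV // mul1r invfM mulrC.
Qed.

(* Choosing the cardinal of Y uniformly and then Y uniformly among the subsets
   of M of that cardinal is consistent under restriction to a subset D. *)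
Lemma sum_subset_invbin (g : {set T} -> R) D M : D \subset M ->
  (\sum_(Y : {set T} | Y \subset M) g (Y :&: D) / 'C(#|M|, #|Y|)%:R) / #|M|.+1%:R =
  (\sum_(Y : {set T} | Y \subset D) g Y / 'C(#|D|, #|Y|)%:R) / #|D|.+1%:R.
Proof.
move=> DM; have [k] := ubnP #|M|; elim: k M DM => // k IHk M DM leMk.
have [MD|[j /setDP[jM jD]]] := set_0Vmem (M :\: D).
  have -> : M = D by apply/eqP; rewrite eqEsubset DM -setD_eq0 MD eqxx.
  by congr (_ / _); apply: eq_bigr => Y YD; rewrite (setIidPl YD).
have cM : #|M| = #|M :\ j|.+1 by rewrite (cardsD1 j) jM.
rewrite -(IHk (M :\ j)); first last.
- by move: leMk; rewrite cM.
- by rewrite subsetD1 DM.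
(* [Y] and [j |: Y] have the same trace on [D] because [j] lies outside [D]; their two weights merge
   by [invr_bin_addn]. *)
rewrite -{1}(setD1K jM) sum_subsetU1 ?setD11 // !mulr_suml.
apply: eq_bigr => Y YM; rewrite cM.
have jY : j \notin Y by apply: contraL YM => jY; apply/subsetPn; exists j; rewrite ?setD11.
have -> : (j |: Y) :&: D = Y :&: D.
  by rewrite setIUl (disjoint_setI0 _) ?set0U // disjoints1.
by rewrite cardsU1 jY -mulrDr -!mulrA invr_bin_addn // subset_leq_card.
Qed.

Lemma sum_sign (d : nat) : \sum_(k < d.+1) (-1) ^+ k = (~~ odd d)%:R :> R.
Proof.
elim: d => [|d IH]; first by rewrite big_ord1.
by rewrite big_ord_recr /= IH -signr_odd /=;
  case: (odd d); rewrite /= ?expr0 ?expr1 ?add0r ?subrr.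
Qed.

(** After restriction to [D] the reciprocal binomial cancels the number of subsets of each size.
    What remains is an alternating sum of #|D| + 1 signs. *)
Lemma sum_sign_invbin D M : D \subset M ->
  \sum_(Y : {set T} | Y \subset M) (-1) ^+ #|Y :&: D| / 'C(#|M|, #|Y|)%:R =
  #|M|.+1%:R * (~~ odd #|D|)%:R / #|D|.+1%:R :> R.
Proof.
move=> DM; have := sum_subset_invbin (fun Y => (-1) ^+ #|Y|) DM.
rewrite (sum_subset_card D (fun k => (-1) ^+ k / 'C(#|D|, k)%:R)).
rewrite (eq_bigr (fun k : 'I__ => (-1) ^+ k)) => [|k _].
  rewrite sum_sign => H; rewrite -mulrA -H mulrCA divff ?mulr1 //.
  by rewrite pnatr_eq0.
by rewrite -[LHS]mulr_natr divfK // pnatr_eq0 -lt0n bin_gt0 -ltnS.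
Qed.

Lemma sum_invbin M :
  \sum_(Y : {set T} | Y \subset M) 'C(#|M|, #|Y|)%:R^-1 = #|M|.+1%:R :> R.
Proof.
have := @sum_sign_invbin set0 M (sub0set _); rewrite cards0 mulr1 divr1 => <-.
by apply: eq_bigr => Y _; rewrite setI0 cards0 mul1r.
Qed.

End Polya.

(** * Sums over the labelings of a measured set by X, Y and Z *)

Section Labelings.
Variables (R : realFieldType) (T : finType).
Implicit Types (D M Y Z : {set T}).

(** A labeling is encoded by its Z-set and its Y-set; the qubits of [M] in neither set carry X. *)
Definition label_sum M (F : {set T} -> {set T} -> R) : R :=
  \sum_(Z : {set T} | Z \subset M) \sum_(Y : {set T} | Y \subset M :\: Z) F Y Z.

Lemma label_sumD M F G :
  label_sum M (fun Y Z => F Y Z + G Y Z) = label_sum M F + label_sum M G.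
Proof. by rewrite /label_sum -big_split; apply: eq_bigr => Z _; rewrite big_split. Qed.

Lemma label_sumZ M a F : label_sum M (fun Y Z => a * F Y Z) = a * label_sum M F.
Proof.
by rewrite /label_sum mulr_sumr; apply: eq_bigr => Z _; rewrite mulr_sumr.
Qed.

Lemma eq_label_sum M F G :
  (forall Y Z, Z \subset M -> Y \subset M :\: Z -> F Y Z = G Y Z) ->
  label_sum M F = label_sum M G.
Proof. by move=> FG; apply: eq_bigr => Z ZM; apply: eq_bigr => Y; apply: FG. Qed.

Lemma ler_label_sum M F G :
  (forall Y Z, Z \subset M -> Y \subset M :\: Z -> F Y Z <= G Y Z) ->
  label_sum M F <= label_sum M G.
Proof. by move=> FG; apply: ler_sum => Z ZM; apply: ler_sum => Y; apply: FG. Qed.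

Lemma label_sum_set0 M F :
  label_sum M (fun Y Z => (Z == set0)%:R * F Y Z) =
  \sum_(Y : {set T} | Y \subset M) F Y set0.
Proof.
rewrite /label_sum (bigD1 set0) ?sub0set //= [X in _ + X]big1 ?addr0.
  by rewrite setD0; apply: eq_bigr => Y _; rewrite eqxx mul1r.
by move=> Z /andP[_ /negPf ->]; rewrite big1 // => Y _; rewrite mul0r.
Qed.

(** The pairs summed over are the disjoint pairs of subsets of [M], a symmetric condition. This
    exchanges the labels Y and Z; [label_sum_compl] exchanges X and Y. *)
Lemma label_sum_swap M F : label_sum M F = label_sum M (fun Y Z => F Z Y).
Proof.
have sub_swap Y Z : (Z \subset M) && (Y \subset M :\: Z) =
    (Y \subset M) && (Z \subset M :\: Y).
  by rewrite !subsetD disjoint_sym; case: (Z \subset M); case: (Y \subset M).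
rewrite /label_sum (exchange_big_dep (fun Y => Y \subset M)) /=.
  apply: eq_bigr => Y YM; apply: eq_bigl => Z.
  by rewrite sub_swap YM.
by move=> Z Y ZM YM; have := sub_swap Y Z; rewrite ZM YM => /esym/andP[].
Qed.

Lemma label_sum_compl M F :
  label_sum M F = label_sum M (fun Y Z => F ((M :\: Z) :\: Y) Z).
Proof.
apply: eq_bigr => Z _.
rewrite (reindex_onto (fun Y => (M :\: Z) :\: Y) (fun Y => (M :\: Z) :\: Y)) /=.
  apply: eq_bigl => Y; rewrite subsetDl /= setDDr setDv set0U.
  by apply/eqP/idP => [<-|/setIidPr //]; apply: subsetIl.
by move=> Y YM; rewrite setDDr setDv set0U; apply/setIidPr.
Qed.

(** The qubit [j] carries exactly one of the three labels, and the two exchanges of labels preserve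
    [W], so the three shares of the total are equal. *)
Lemma label_sum_third (t : nat) (W : nat -> nat -> R) M j : #|M| = t ->
  (forall a b c, (a + b + c)%N = t -> W b c = W c b /\ W b c = W a c) ->
  j \in M ->
  label_sum M (fun Y Z => (j \in Z)%:R * W #|Y| #|Z|) =
  label_sum M (fun Y Z => W #|Y| #|Z|) / 3.
Proof.
move=> Mt Wsym jM.
have cardYZ Y Z : Z \subset M -> Y \subset M :\: Z ->
    (#|(M :\: Z) :\: Y| + #|Y| + #|Z| = t)%N.
  move=> ZM YM; rewrite -Mt -(cardsID Z M) (setIidPr ZM).
  by rewrite -(cardsID Y (M :\: Z)) (setIidPr YM); lia.
set SZ := label_sum _ _; set S := label_sum _ _.
pose SY := label_sum M (fun Y Z => (j \in Y)%:R * W #|Y| #|Z|).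
pose SX := label_sum M (fun Y Z => (j \in (M :\: Z) :\: Y)%:R * W #|Y| #|Z|).
have ZY : SZ = SY.
  rewrite /SZ label_sum_swap; apply: eq_label_sum => Y Z ZM YM.
  by rewrite (Wsym _ _ _ (cardYZ Y Z ZM YM)).1.
have YX : SY = SX.
  rewrite /SY label_sum_compl; apply: eq_label_sum => Y Z ZM YM.
  by rewrite (Wsym _ _ _ (cardYZ Y Z ZM YM)).2.
have : S = SX + SY + SZ.
  rewrite -!label_sumD; apply: eq_label_sum => Y Z ZM YM.
  rewrite -!mulrDl -!natrD !inE jM andbT.
  have : (j \in Y) ==> (j \notin Z).
    by apply/implyP => /(subsetP YM); rewrite inE => /andP[].
  by case: (j \in Y); case: (j \in Z); rewrite //= mul1r.
by rewrite -YX -ZY => ->; field.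
Qed.

(* Eigenvalue of the test operator for the Z-set Z and the Y-set Y on the
   stabilizer state of sign e whose bits differ on D from the unmeasured ones. *)
Definition label_eig D (e : R) Y Z : R :=
  (Z :&: D == set0)%:R * (if Z == set0 then 2^-1 else 1) +
  e * ((Z == set0)%:R / 2 * (-1) ^+ #|Y :&: D|).

Section Gap.
Variables (M : {set T}) (W : nat -> nat -> R).
Let tot := label_sum M (fun Y Z => W #|Y| #|Z|).
Let noZ := \sum_(Y : {set T} | Y \subset M) W #|Y| 0%N.

(** With empty [D] a labeling containing a Z has eigenvalue 1 and one without Z has (1 + e) / 2, so
    only the latter lose weight. *)
Lemma label_eig_set0 (e : R) :
  label_sum M (fun Y Z => label_eig set0 e Y Z * W #|Y| #|Z|) =
  tot - (1 - e) / 2 * noZ.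
Proof.
have -> : noZ = \sum_(Y : {set T} | Y \subset M) W #|Y| #|set0 : {set T}|.
  by rewrite cards0.
rewrite -(label_sum_set0 M (fun Y Z => W #|Y| #|Z|)) -mulNr -label_sumZ -label_sumD.
apply: eq_label_sum => Y Z _ _; rewrite /label_eig !setI0 eqxx cards0 expr0.
by case: (Z == set0) => /=; field.
Qed.

(** Fix [j] in [D]. Labelings with [j] in [Z] contribute 0 and weigh tot / 3, the others with a Z
    contribute at most their weight, and those without Z contribute the fraction (1 + e (-1)^#|Y :&:
    D|) / 2. The assumed bound is what the resulting estimate requires. *)
Lemma label_eig_le D (e : R) (t : nat) :
  #|M| = t ->
  (forall a b c, (a + b + c)%N = t -> W b c = W c b /\ W b c = W a c) ->
  (forall b c, 0 <= W b c) ->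
  D \subset M -> D != set0 ->
  noZ + e * (\sum_(Y : {set T} | Y \subset M) (-1) ^+ #|Y :&: D| * W #|Y| 0%N)
    <= 2 / 3 * tot ->
  label_sum M (fun Y Z => label_eig D e Y Z * W #|Y| #|Z|) <= tot - noZ.
Proof.
move=> Mt Wsym W0 DM /set0Pn[j jD].
set S := \sum_(Y | _) _ => bound.
pose S' := label_sum M (fun Y Z =>
  (Z == set0)%:R * ((-1) ^+ #|Y :&: D| * W #|Y| #|Z|)).
pose noZ' := label_sum M (fun Y Z => (Z == set0)%:R * W #|Y| #|Z|).
have SE : S = S' by rewrite /S' label_sum_set0 cards0.
have noZE : noZ = noZ' by rewrite /noZ' label_sum_set0 cards0.
have third := label_sum_third Mt Wsym (subsetP DM _ jD).
(* The intermediate value is itself a sum over labelings, so the first inequality is checked label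
   by label; it is an equality when [Z] is empty. *)
apply: (@le_trans _ _ (tot + (- 1) * (tot / 3) + (- (1 / 2)) * noZ' + (e / 2) * S')).
  rewrite /tot -third /S' /noZ' -!label_sumZ -!label_sumD.
  apply: ler_label_sum => Y Z ZM YM; rewrite /label_eig.
  have [->|Z0] := eqVneq Z set0.
    by rewrite inE set0I eqxx /=; rewrite le_eqVlt; apply/orP; left; apply/eqP; field.
  rewrite /= !(mul0r, mulr0, addr0) mulr1.
  have := W0 #|Y| #|Z|; set w := W _ _ => w0.
  have [ZD|] := eqVneq (Z :&: D) set0.
    have -> : j \in Z = false; last by rewrite /=; lra.
    by apply/negP=> jZ; move/setP/(_ j): ZD; rewrite !inE jZ jD.
  by case: (j \in Z) => /=; lra.
by rewrite -SE -noZE; lra.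
Qed.

End Gap.

(** Binomial theorem. Using a = 2 for the choice of [Z] and a = 1 for the choice of [Y] it counts
    labelings. *)
Lemma sum_pow_subset M (a : R) :
  \sum_(Y : {set T} | Y \subset M) a ^+ #|M :\: Y| = (a + 1) ^+ #|M|.
Proof.
rewrite (eq_bigr (fun Y : {set T} => a ^+ (#|M| - #|Y|))); last first.
  by move=> Y YM; rewrite cardsD (setIidPr YM).
rewrite (sum_subset_card M (fun k => a ^+ (#|M| - k))) exprDn.
by apply: eq_bigr => k _; rewrite expr1n mulr1.
Qed.

(** Adding or removing a fixed [j] of [D] pairs the subsets with opposite signs. *)
Lemma sum_sign_setI D M : D \subset M -> D != set0 ->
  \sum_(Y : {set T} | Y \subset M) (-1) ^+ #|Y :&: D| = 0 :> R.
Proof.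
move=> DM /set0Pn[j jD]; have jM := subsetP DM _ jD.
rewrite -{1}(setD1K jM) sum_subsetU1 ?setD11 // big1 // => Y YM.
have jY : j \notin Y by apply: contraL YM => jY; apply/subsetPn; exists j; rewrite ?setD11.
have jD1 : [set j] :&: D = [set j] by apply/setIidPl; rewrite sub1set.
rewrite setIUl jD1 cardsU1 inE (negPf jY) exprS mulN1r subrr //.
Qed.

End Labelings.

(* Inverse of the number of labelings of t qubits with b labels Y and c labels Z. *)
Definition class_weight (R : realFieldType) (t b c : nat) : R :=
  ('C(t, c) * 'C(t - c, b))%:R^-1.

(** * The bounds for the constant weight and for the class weight *)

Section Weights.
Variables (R : realFieldType) (T : finType) (M : {set T}).
Let t := #|M|.

Lemma label_sum_const : label_sum M (fun _ _ => 1 : R) = 3 ^+ t.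
Proof.
rewrite (_ : 3 = 2 + 1) -?sum_pow_subset; last by lra.
apply: eq_bigr => Z _; rewrite (_ : 2 = 1 + 1) -?sum_pow_subset; last by lra.
by apply: eq_bigr => Y _; rewrite expr1n.
Qed.

(** The signed sum vanishes, so the condition of [label_eig_le] reduces to 2^(t-1) <= 3^(t-1). *)
Lemma label_eig_const_le (D : {set T}) (e : R) : (0 < t)%N -> D \subset M -> D != set0 ->
  label_sum M (fun Y Z => label_eig D e Y Z * 1) <= 3 ^+ t - 2 ^+ t.
Proof.
move=> t0 DM D0.
have noZE : \sum_(Y : {set T} | Y \subset M) 1 = 2 ^+ t :> R.
  rewrite (_ : 2 = 1 + 1) -?sum_pow_subset; last by lra.
  by apply: eq_bigr => Y _; rewrite expr1n.
have := @label_eig_le R T M (fun _ _ => 1) D e t (erefl _).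
rewrite label_sum_const noZE; apply => //.
under eq_bigr do rewrite mulr1.
rewrite sum_sign_setI // mulr0 addr0.
rewrite -(prednK t0) !exprS.
have : 2 ^+ t.-1 <= 3 ^+ t.-1 :> R by apply: lerXn2r; rewrite ?nnegrE ?ler_nat.
lra.
Qed.

(** The class weight equals a! b! c! / t!, which is symmetric in the three counts. *)
Lemma class_weight_sym a b c : (a + b + c)%N = t ->
  class_weight R t b c = class_weight R t c b /\ class_weight R t b c = class_weight R t a c.
Proof.
have binbin a' b' c' : (a' + b' + c')%N = t ->
    ('C(t, c') * 'C(t - c', b') * (a'`! * b'`! * c'`!) = t`!)%N.
  move=> E; have c't : (c' <= t)%N by lia.
  have b't : (b' <= t - c')%N by lia.
  rewrite -(bin_fact c't) -(bin_fact b't) (_ : t - c' - b' = a')%N; last by lia.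
  by rewrite -!mulnA; congr (_ * _)%N; lia.
have eqw a' b' c' a'' b'' c'' : (a' + b' + c')%N = t -> (a'' + b'' + c'')%N = t ->
    (a'`! * b'`! * c'`! = a''`! * b''`! * c''`!)%N ->
    class_weight R t b' c' = class_weight R t b'' c''.
  move=> E' E'' Ef; congr (_%:R^-1); apply/eqP.
  by rewrite -(eqn_pmul2r (_ : 0 < a'`! * b'`! * c'`!)%N) ?muln_gt0 ?fact_gt0 //
    (binbin _ _ _ E') Ef (binbin _ _ _ E'').
by move=> E; split; [apply: (eqw a _ _ a) | apply: (eqw a _ _ b)] => //; lia.
Qed.

Lemma sum_class_weight0 :
  \sum_(Y : {set T} | Y \subset M) class_weight R t #|Y| 0 = t.+1%:R.
Proof.
rewrite -(sum_invbin R M); apply: eq_bigr => Y _.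
by rewrite /class_weight bin0 mul1n subn0.
Qed.

(** Every triple of counts has total weight 1, so this is the number of classes. For fixed [Z] the
    sum over [Y] leaves (t - #|Z| + 1) / C(t, #|Z|), and summing over [Z] yields a triangular
    number. *)
Lemma label_sum_class_weight :
  label_sum M (fun Y Z => class_weight R t #|Y| #|Z|) = ((t + 1) * (t + 2))%:R / 2.
Proof.
rewrite /label_sum (eq_bigr (fun Z : {set T} => (t - #|Z|).+1%:R / 'C(t, #|Z|)%:R)).
  rewrite (sum_subset_card M (fun k => (t - k).+1%:R / 'C(t, k)%:R)).
  rewrite (eq_bigr (fun k : 'I_t.+1 => (t - k).+1%:R)); last first.
    by move=> k _; rewrite -[LHS]mulr_natr divfK // pnatr_eq0 -lt0n bin_gt0 -ltnS.
  rewrite (reindex_inj rev_ord_inj) /=.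
  rewrite (eq_bigr (fun k : 'I_t.+1 => k.+1%:R)); last first.
    by move=> k _; congr (_.+1%:R); have := ltn_ord k; lia.
  elim: t => [|m IH]; first
    by rewrite big_ord1 (_ : ((0 + 1) * (0 + 2))%N = 2) // divff ?pnatr_eq0.
  by rewrite big_ord_recr /= IH !natrM !natrD -[m.+2]addn2 -[m.+1]addn1 !natrD; field.
move=> Z ZM; rewrite -[in RHS](_ : #|M :\: Z| = t - #|Z|)%N; last first.
  by rewrite cardsD (setIidPr ZM).
rewrite -(sum_invbin R) mulr_suml; apply: eq_bigr => Y _.
by rewrite /class_weight natrM invfM mulrC cardsD (setIidPr ZM).
Qed.

(** The condition of [label_eig_le] reads t + 1 + e S <= (t + 1)(t + 2) / 3. For odd #|D| one has S
    = 0 and t >= 1 suffices; for even #|D| one has #|D| >= 2, hence t >= 2 and S <= (t + 1) / 3. *)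
Lemma label_eig_class_le (D : {set T}) (e : R) : (0 < t)%N -> D \subset M -> D != set0 ->
  `|e| = 1 ->
  label_sum M (fun Y Z => label_eig D e Y Z * class_weight R t #|Y| #|Z|) <=
  ((t + 1) * (t + 2))%:R / 2 - t.+1%:R.
Proof.
move=> t0 DM D0 e1.
have := @label_eig_le R T M (class_weight R t) D e t (erefl _) class_weight_sym.
rewrite label_sum_class_weight sum_class_weight0; apply => //.
  by move=> b c; rewrite invr_ge0 ler0n.
under eq_bigr => Y _ do rewrite /class_weight bin0 mul1n subn0.
rewrite sum_sign_invbin // -/t natrM !natrD -[t.+1]addn1 natrD.
have d0 : (0 < #|D|)%N by rewrite card_gt0.
have dt : (#|D| <= t)%N by rewrite subset_leq_card.
set d := #|D| in d0 dt *.
have t1 : 1 <= t%:R :> R by rewrite ler1n.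
have [od|ed] /= := boolP (odd d); first by rewrite !(mulr0, mul0r); nra.
have t2 : 2 <= t%:R :> R.
  by rewrite ler_nat (leq_trans _ dt) //; case: d d0 ed dt => [|[|?]].
have d3 : d.+1%:R^-1 <= 3^-1 :> R.
  rewrite lef_pV2 ?posrE ?ltr0n // ler_nat.
  by case: d d0 ed dt => [|[|?]].
have eq : e * ((t%:R + 1) * 1 / d.+1%:R) <= (t%:R + 1) / 3.
  rewrite (le_trans (ler_norm _)) // normrM e1 mul1r mulr1 ger0_norm; last first.
    by rewrite mulr_ge0 ?invr_ge0 ?ler0n // addr_ge0.
  by rewrite ler_pM2l // ltr_wpDl.
apply: (le_trans (lerD (lexx _) eq)); nra.
Qed.

End Weights.

(** * Entries of the test operators *)

Section QubitEntries.
Variable C : numClosedFieldType.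

Lemma Z2P (a : 'Z_2) : a = 0 \/ a = 1.
Proof. by case: a => [[|[|?]] ?] //; [left|right]; apply: val_inj. Qed.

Lemma sum_Z2 (V : nmodType) (F : 'Z_2 -> V) : \sum_a F a = F 0 + F 1.
Proof.
rewrite (bigD1 0) //= (bigD1 1) //= big1 ?addr0 // => a.
by case: (Z2P a) => ->.
Qed.

Definition qubit_proj (p q v : 'Z_2) : 'M[C]_2 :=
  2^-1 *: (1%:M + (-1) ^+ v *: pauli C p q).

(** Sum over the outcomes v of the entry (x, y) times the entry (b, a) of the projector, up to
    normalization. For measured qubits p = 0 means Z; the sign comes from off-diagonal entries of
    Y. *)
Definition qubit_kernel (p q x y a b : 'Z_2) : C :=
  if p == 0 then ((x == a) && (y == a) && (b == a))%:R
  else (x + y == a + b)%:R * (-1) ^+ [&& q == 1, x != y & x != a].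

Lemma qubit_proj_diag p q v a : (p, q) != (0, 0) ->
  qubit_proj p q v a a = if p == 0 then (v == a)%:R else 2^-1.
Proof.
case: (Z2P p) (Z2P q) (Z2P v) (Z2P a) => -> [->|->] [->|->] [->|->] //= _;
  rewrite /qubit_proj /pauli /= !mxE /=; by field.
Qed.

Lemma sum_qubit_proj p q x y a b : (p, q) != (0, 0) ->
  \sum_v qubit_proj p q v x y * qubit_proj p q v b a =
  (if p == 0 then 1 else 2^-1) * qubit_kernel p q x y a b.
Proof.
rewrite sum_Z2; have ii : 'i ^+ 2 = -1 :> C by exact: sqrCi.
case: (Z2P p) (Z2P q) (Z2P x) (Z2P y) (Z2P a) (Z2P b)
    => -> [->|->] [->|->] [->|->] [->|->] [->|->] //= _;
  rewrite /qubit_proj /qubit_kernel /pauli /= !mxE /=; try by field.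
all: by field: ii.
Qed.
End QubitEntries.

(** * Entrywise calculus of register operators *)

Section Register.
Variables (C : numClosedFieldType) (Q : finType).
Implicit Types (A B : qop C Q) (x y : bits Q).

Definition cst (a : 'Z_2) : bits Q := [ffun=> a].
Definition flip (x : bits Q) : bits Q := [ffun j => x j + 1].

Lemma flipK : involutive flip.
Proof.
by move=> x; apply/ffunP=> j; rewrite !ffunE; case: (Z2P (x j)) => ->; apply: val_inj.
Qed.

Lemma qentry_mkqop (f : bits Q -> bits Q -> C) x y : qentry (mkqop f) x y = f x y.
Proof. by rewrite /qentry mxE !enum_rankK. Qed.

Lemma qentry_mul A B x y : qentry (A *m B) x y = \sum_z qentry A x z * qentry B z y.
Proof. by rewrite /qentry mxE sum_bits. Qed.

Lemma qentry1 x y : qentry (1%:M : qop C Q) x y = (x == y)%:R.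
Proof. by rewrite /qentry mxE (inj_eq enum_rank_inj). Qed.

Lemma qentryZ (a : C) A x y : qentry (a *: A) x y = a * qentry A x y.
Proof. by rewrite /qentry mxE. Qed.

Lemma qentry_sum (I : finType) (P : pred I) (F : I -> qop C Q) x y :
  qentry (\sum_(i | P i) F i) x y = \sum_(i | P i) qentry (F i) x y.
Proof. by rewrite /qentry summxE. Qed.

Lemma qentryP A B : (forall x y, qentry A x y = qentry B x y) -> A = B.
Proof.
move=> AB; apply/matrixP=> i j; rewrite -(enum_valK i) -(enum_valK j).
exact: AB.
Qed.

Lemma trace_qentry A : \tr A = \sum_x qentry A x x.
Proof. by rewrite /mxtrace sum_bits. Qed.

End Register.

Lemma restr_cst (n : nat) (J : {set 'I_n}) a : restr J (cst _ a) = cst _ a.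
Proof. by apply/ffunP=> j; rewrite !ffunE. Qed.

Lemma restr_eq_cst n (J : {set 'I_n}) (x : bits 'I_n) a :
  (restr J x == cst _ a) = [forall j in J, x j == a].
Proof.
apply/eqP/forall_inP=> [E j jJ|E].
  by move/ffunP: E => /(_ (Sub j jJ)); rewrite !ffunE => ->.
by apply/ffunP=> j; rewrite !ffunE; apply/eqP/E/(valP j).
Qed.

(** * Trace and partial trace of the measured GHZ state *)

Section TestOp.
Variables (C : numClosedFieldType) (n : nat) (mu : symp n).
Hypothesis unmeasured : (0 < #|~: measured mu|)%N.
Let J := measured mu.

Definition zset : {set 'I_n} := [set j | (mux mu j == 0) && (muz mu j == 1)].
Definition yset : {set 'I_n} := [set j | (mux mu j == 1) && (muz mu j == 1)].

(** Some qubit is unmeasured, so the branches 0...0 and 1...1 stay distinct off [J]. *)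
Lemma cst_inj : injective (cst (subreg (~: J))).
Proof.
case/card_gt0P: unmeasured => j jU a b /ffunP/(_ (Sub j jU)).
by rewrite !ffunE.
Qed.

Lemma rho_entry x y : qentry (rho C n) x y =
  2^-1 * \sum_a \sum_b ((x == cst _ a) && (y == cst _ b))%:R.
Proof.
have ghzE z : ghz C n (enum_rank z) 0 = (sqrtC 2)^-1 * \sum_a (z == cst _ a)%:R.
  rewrite !mxE sum_Z2 !(inj_eq enum_rank_inj) !eqxx !andbT.
  by congr (_ * (_%:R + _%:R)).
have r2 : (sqrtC 2)^-1 \is @Num.real C by rewrite realV ger0_real // sqrtC_ge0.
rewrite /qentry /rho mxE big_ord1 ghzE.
rewrite (_ : (ghz C n ^t* ) 0 _ = (ghz C n (enum_rank y) 0)^*); last by rewrite !mxE.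
rewrite ghzE rmorphM /= (CrealP r2).
rewrite rmorph_sum /= mulrACA -expr2 exprVn sqrtCK; congr (_ * _).
rewrite mulr_suml; apply: eq_bigr => a _; rewrite mulr_sumr; apply: eq_bigr => b _.
by rewrite rmorph_nat -natrM mulnb.
Qed.

Definition pmeas (v : bits (subreg J)) (x y : bits 'I_n) : C :=
  qentry (proj C v) (restr J x) (restr J y).

Lemma pmeasE v x y : pmeas v x y =
  \prod_(j : subreg J)
    qubit_proj C (mux mu (val j)) (muz mu (val j)) (v j) (x (val j)) (y (val j)).
Proof.
rewrite /pmeas /proj /tens qentry_mkqop; apply: eq_bigr => j _.
by rewrite !ffunE.
Qed.

Lemma rho_proj_entry v x y : qentry (rho_proj C v) x y =
  2^-1 * \sum_a \sum_b
    ((x == cst _ a) && (restr (~: J) y == cst _ b))%:R * pmeas v (cst _ b) y.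
Proof.
rewrite /rho_proj qentry_mul.
under eq_bigr => z _ do rewrite rho_entry -mulrA mulr_suml.
rewrite -mulr_sumr exchange_big /=; congr (_ * _); apply: eq_bigr => a _.
under eq_bigr => z _ do rewrite mulr_suml.
rewrite exchange_big /=; apply: eq_bigr => b _.
rewrite (bigD1 (cst _ b)) //= eqxx andbT big1 ?addr0 => [|z /negPf ->].
  rewrite /otimes qentry_mkqop qentry1 (restr_cst (~: J)) (eq_sym (cst _ _)).
  by rewrite -mulnb natrM -/(pmeas v _ _); ring.
by rewrite andbF mul0r.
Qed.

(** The cross terms between the two branches drop out of the trace since the branches differ off
    [J]. *)
Lemma tr_rho_proj v : \tr (rho_proj C v) = 2^-1 * \sum_a pmeas v (cst _ a) (cst _ a).
Proof.
rewrite trace_qentry; under eq_bigr => x _ do rewrite rho_proj_entry.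
rewrite -mulr_sumr exchange_big /=; congr (_ * _); apply: eq_bigr => a _.
rewrite exchange_big /= (bigD1 a) //= (bigD1 (cst _ a)) //= restr_cst !eqxx mul1r.
rewrite big1 => [|x /negPf ->]; last by rewrite mul0r.
rewrite big1 ?addr0 // => b /negPf ba; rewrite big1 // => x _.
case: eqP => [->|_]; last by rewrite mul0r.
by rewrite restr_cst (inj_eq cst_inj) eq_sym ba mul0r.
Qed.

Lemma ptrace_rho_proj v a' b' : qentry (ptrace J (rho_proj C v)) a' b' =
  2^-1 * \sum_a \sum_b ((a' == cst _ a) && (b' == cst _ b))%:R * pmeas v (cst _ b) (cst _ a).
Proof.
rewrite /ptrace qentry_mkqop.
under eq_bigr => x _ do under eq_bigr => y _ do rewrite rho_proj_entry.
under eq_bigr => x _ do rewrite -mulr_sumr exchange_big /=.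
rewrite -mulr_sumr exchange_big /=; congr (_ * _); apply: eq_bigr => a _.
under eq_bigr => x _ do rewrite exchange_big /=.
rewrite exchange_big /=; apply: eq_bigr => b _.
have [Ea|Ea] := eqVneq a' (cst _ a); last first.
  rewrite mul0r big1 // => x /eqP xa; rewrite big1 // => y _.
  case: eqP => [xE|_]; last by rewrite mul0r.
  by move: Ea; rewrite -xa xE restr_cst eqxx.
rewrite (bigD1 (cst _ a)) /= ?restr_cst ?Ea ?eqxx // [X in _ + X]big1 ?addr0; last first.
  by move=> x /andP[_ /negPf ->]; rewrite big1 // => y _; rewrite mul0r.
have [Eb|Eb] := eqVneq b' (cst _ b); last first.
  rewrite mul0r big1 // => y /andP[/eqP yb _].
  by rewrite yb (negPf Eb) mul0r.
(* The only index left in the inner sum: it agrees with the constant a on [J] and with b off [J]. *)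
pose y0 : bits 'I_n := [ffun j => if j \in J then a else b].
have y0J : restr J y0 = cst _ a.
  by apply/ffunP=> j; rewrite !ffunE (valP j).
have y0U : restr (~: J) y0 = cst _ b.
  by apply/ffunP=> j; rewrite !ffunE; have := valP j; rewrite inE => /negPf ->.
rewrite (big_pred1 y0) => [|y /=].
  by rewrite y0U !eqxx /pmeas y0J !restr_cst.
rewrite Eb; apply/andP/eqP => [[/eqP yU /eqP yJ]|->]; last by rewrite y0U y0J !eqxx.
apply/ffunP=> j; rewrite ffunE; case: ifPn => jJ.
  by move/ffunP: yJ => /(_ (Sub j jJ)); rewrite !ffunE.
have jU : j \in ~: J by rewrite inE.
by move/ffunP: yU => /(_ (Sub j jU)); rewrite !ffunE.
Qed.

End TestOp.

(** * Closed form of the entries of a test operator *)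

Section TestOpEntries.
Variables (C : numClosedFieldType) (n : nat) (mu : symp n).
Hypothesis unmeasured : (0 < #|~: measured mu|)%N.
Let J := measured mu.

Lemma measured_neq0 j : j \in J -> (mux mu j, muz mu j) != (0, 0).
Proof. by rewrite inE. Qed.

Lemma in_zset j : (j \in zset mu) = (j \in J) && (mux mu j == 0).
Proof.
rewrite !inE; case: (Z2P (mux mu j)) => ->; case: (Z2P (muz mu j)) => -> //.
Qed.

Let half : C := \prod_(j in J) (if mux mu j == 0 then 1 else 2^-1).
Let coef : C := if zset mu == set0 then 2^-1 else 1.

Lemma half_neq0 : half != 0.
Proof.
apply/prodf_neq0=> j _; case: ifP => _; first exact: oner_neq0.
by rewrite invr_neq0 // pnatr_eq0.
Qed.

Lemma pmeas_diag (v : bits (subreg (measured mu))) a : pmeas C v (cst _ a) (cst _ a) =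
  half * \prod_(j : subreg J) (if mux mu (val j) == 0 then (v j == a)%:R else 1).
Proof.
rewrite pmeasE /half [X in X * _]big_sub -big_split /=; apply: eq_bigr => j _.
rewrite !ffunE qubit_proj_diag ?measured_neq0 ?(valP j) //.
by case: ifP => _; rewrite ?mul1r ?mulr1.
Qed.

(** Without Z both branches are compatible with every outcome, which has probability [half]. With a
    Z at most one branch is, so the probability is [half] / 2 or 0, and in the latter case both
    sides vanish. *)
Lemma pmeas_tr (v : bits (subreg (measured mu))) a b :
  (\tr (rho_proj C v))^-1 * (2^-1 * pmeas C v (cst _ b) (cst _ a)) =
  coef / half * pmeas C v (cst _ b) (cst _ a).
Proof.
rewrite tr_rho_proj // sum_Z2 !pmeas_diag -mulrDr.
have h0 := half_neq0; have n2 : 2 != 0 :> C by rewrite pnatr_eq0.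
rewrite /coef; have [Z0|Z0] := eqVneq (zset mu) set0.
  have e1 w : \prod_(j : subreg J)
      (if mux mu (val j) == 0 then (v j == w)%:R else 1) = 1 :> C.
    apply: big1 => j _; case: ifP => // mj.
    have : val j \in zset mu by rewrite in_zset mj (valP j).
    by rewrite Z0 inE.
  by rewrite !e1; field; rewrite ?n2 ?h0.
case/set0Pn: Z0 => j0; rewrite in_zset => /andP[jJ mj0].
pose k : subreg J := Sub j0 jJ.
(* Here [e] tells whether all Z outcomes equal w; the outcome at [k] then excludes one of the two
   branches. *)
have eb w : exists e : bool, \prod_(j : subreg J)
      (if mux mu (val j) == 0 then (v j == w)%:R else 1) = e%:R :> C /\
      (e -> v k = w).
  have [/forallP ok|/forallPn[j]] :=
    boolP [forall j : subreg J, (mux mu (val j) == 0) ==> (v j == w)].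
    exists true; split=> [|_]; last by apply/eqP; have := ok k; rewrite /= mj0.
    by apply: big1 => j _; have := ok j; case: ifP => //= _ ->.
  rewrite negb_imply => /andP[mj /negPf vj]; exists false; split=> //.
  by rewrite (bigD1 j) //= mj vj mul0r.
have pk0 : v k != b \/ a != b -> pmeas C v (cst _ b) (cst _ a) = 0.
  move=> h; rewrite pmeasE (bigD1 k) //= (eqP mj0) !ffunE.
  have := measured_neq0 jJ; rewrite (eqP mj0).
  case: (Z2P (muz mu j0)) => -> // _.
  rewrite (_ : qubit_proj C 0 1 (v k) b a = 0) ?mul0r //.
  rewrite /qubit_proj /pauli /= !mxE /=.
  case: (Z2P b) (Z2P a) (Z2P (v k)) h => -> [->|->] [->|->] [] // _; rewrite /=; by field.
have [vb|vb] := eqVneq (v k) b; last by rewrite pk0 ?mulr0 //; left.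
have [->|ab] := eqVneq a b; last by rewrite pk0 ?mulr0 //; right.
have [e0 [E0 h0']] := eb 0; have [e1 [E1 h1']] := eb 1.
rewrite pmeas_diag E0 E1; case: (Z2P b) vb => -> vb; rewrite vb in h0' h1'; rewrite ?E0 ?E1.
  have -> : e1 = false by apply/negP=> /h1'.
  by case: (e0); rewrite /= ?mulr0 //; field; rewrite ?h0 ?n2.
have -> : e0 = false by apply/negP=> /h0'.
by case: (e1); rewrite /= ?mulr0 //; field; rewrite ?h0 ?n2.
Qed.

Definition differ (a : 'Z_2) (x : bits 'I_n) : {set 'I_n} := [set j | x j != a].

Lemma restr_differ a x : (restr (~: J) x == cst _ a) = (differ a x \subset J).
Proof.
rewrite restr_eq_cst; apply/forall_inP/subsetP=> H j.
  by rewrite inE; apply: contraR => jJ; apply: H; rewrite inE.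
by rewrite inE; apply: contraR => xj; apply: H; rewrite inE.
Qed.

(** By [pmeas_tr] the normalization is the same for all contributing outcomes, so the sum over
    outcome strings factors over the measured qubits. *)
Lemma test_op_kernel x y : qentry (test_op C mu) x y =
  coef * \sum_a \sum_b
    ((restr (~: J) x == cst _ a) && (restr (~: J) y == cst _ b))%:R *
    \prod_(j in J) qubit_kernel C (mux mu j) (muz mu j) (x j) (y j) a b.
Proof.
rewrite /test_op qentry_sum.
transitivity (\sum_(v : bits (subreg (measured mu))) \sum_a \sum_b
    ((restr (~: J) x == cst _ a) && (restr (~: J) y == cst _ b))%:R *
    (coef / half * (pmeas C v x y * pmeas C v (cst _ b) (cst _ a)))).
  rewrite big_mkcond; apply: eq_bigr => v _.
  transitivity (pmeas C v x y * ((\tr (rho_proj C v))^-1 *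
      qentry (ptrace (measured mu) (rho_proj C v)) (restr (~: J) x) (restr (~: J) y))).
    (* The omitted outcomes of probability zero can be restored, as the inverse of 0 is 0. *)
    case: ifPn => [_|/negPn/eqP ->]; last by rewrite invr0 mul0r mulr0.
    by rewrite /otimes qentry_mkqop qentryZ.
  rewrite ptrace_rho_proj // !mulr_sumr; apply: eq_bigr => a _.
  rewrite !mulr_sumr; apply: eq_bigr => b _.
  have := pmeas_tr v a b.
  set t := (\tr _)^-1; set p := pmeas C v (cst _ b) _; set q := pmeas C v x y.
  set e := (_ && _)%:R => H.
  have -> : q * (t * (2^-1 * (e * p))) = e * q * (t * (2^-1 * p)) by ring.
  by rewrite H; ring.
rewrite exchange_big /= mulr_sumr; apply: eq_bigr => a _.
rewrite exchange_big /= mulr_sumr; apply: eq_bigr => b _.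
rewrite -!mulr_sumr [RHS]mulrCA; congr (_ * _).
rewrite (eq_bigr (fun v : bits (subreg (measured mu)) => \prod_(j : subreg (measured mu))
   (qubit_proj C (mux mu (val j)) (muz mu (val j)) (v j) (x (val j)) (y (val j)) *
    qubit_proj C (mux mu (val j)) (muz mu (val j)) (v j) b a))); last first.
  move=> v _; rewrite !pmeasE -big_split /=; apply: eq_bigr => j _.
  by rewrite !ffunE.
rewrite -(bigA_distr_bigA (fun (j : subreg (measured mu)) w =>
   qubit_proj C (mux mu (val j)) (muz mu (val j)) w (x (val j)) (y (val j)) *
    qubit_proj C (mux mu (val j)) (muz mu (val j)) w b a)) /=.
under eq_bigr => j _ do rewrite sum_qubit_proj ?measured_neq0 ?(valP j) //.
rewrite big_split /= -(big_sub _ (fun j => if mux mu j == 0 then 1 else 2^-1)).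
rewrite -(big_sub _ (fun j => qubit_kernel C (mux mu j) (muz mu j) (x j) (y j) a b)).
by rewrite -/J -/half -!mulrA; congr (_ * _); rewrite mulKf // half_neq0.
Qed.

Lemma bits_neq (x y : bits 'I_n) : x != y -> exists j, x j != y j.
Proof.
move=> xy; apply/existsP; rewrite -negb_forall; apply: contra xy => /forallP H.
by apply/eqP/ffunP=> j; apply/eqP.
Qed.

(** Off [J] and at Z qubits both bits equal a, and at X and Y qubits the parity condition forces y_j
    = x_j; hence the term is diagonal and vanishes if a Z meets the differing set. *)
Lemma prod_kernel_same a x y :
  ((restr (~: J) x == cst _ a) && (restr (~: J) y == cst _ a))%:R *
    \prod_(j in J) qubit_kernel C (mux mu j) (muz mu j) (x j) (y j) a a =
  (differ a x \subset J)%:R * ((y == x)%:R * (zset mu :&: differ a x == set0)%:R).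
Proof.
rewrite !restr_differ; have [->|/bits_neq[j yxj]] := eqVneq y x; last first.
  rewrite mul0r mulr0; have [xJ|_] := boolP (differ a x \subset J); last by rewrite mul0r.
  have [yJ|_] := boolP (differ a y \subset J); last by rewrite mul0r.
  have jJ : j \in J.
    apply: contraR yxj => jJ; have jx := contra (subsetP xJ j) jJ.
    have jy := contra (subsetP yJ j) jJ.
    by move: jx jy; rewrite !inE !negbK => /eqP -> /eqP ->.
  rewrite (bigD1 j) //= (_ : qubit_kernel _ _ _ _ _ _ _ = 0) ?mul0r ?mulr0 //.
  move: yxj; rewrite /qubit_kernel.
  case: (Z2P (mux mu j)) (Z2P (x j)) (Z2P (y j)) (Z2P a) => -> [->|->] [->|->] [->|->] //=;
    by rewrite mul0r.
rewrite andbb mul1r; congr (_ * _).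
have [Z0|/set0Pn[j]] := eqVneq (zset mu :&: differ a x) set0.
  apply: big1 => j jJ; rewrite /qubit_kernel !eqxx.
  have: j \in zset mu -> x j = a.
    move=> jZ; apply/eqP; apply: contraT => xj.
    by move/setP/(_ j): Z0; rewrite inE jZ !inE xj.
  rewrite in_zset jJ; case: (Z2P (mux mu j)) => -> /= H.
    by rewrite H // eqxx.
  by rewrite andbF /= mulr1; case: (Z2P (x j)) (Z2P a) => -> [->|->].
rewrite in_setI in_zset => /andP[/andP[jJ mj] jD].
have /negPf xj : x j != a by move: jD; rewrite inE.
by rewrite (bigD1 j jJ) /qubit_kernel mj xj /= mul0r.
Qed.

(** Here b = a + 1. A single Z kills the term, the parity condition forces the complement of [x],
    and each Y at which [x] differs from a gives a factor -1. *)
Lemma prod_kernel_diff a b x y : b != a ->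
  ((restr (~: J) x == cst _ a) && (restr (~: J) y == cst _ b))%:R *
    \prod_(j in J) qubit_kernel C (mux mu j) (muz mu j) (x j) (y j) a b =
  (differ a x \subset J)%:R *
    ((y == flip x)%:R * ((zset mu == set0)%:R * (-1) ^+ #|yset mu :&: differ a x|)).
Proof.
move=> ba; rewrite !restr_differ; have [->|/bits_neq[j yxj]] := eqVneq y (flip x); last first.
  rewrite mul0r mulr0; have [xJ|_] := boolP (differ a x \subset J); last by rewrite mul0r.
  have [yJ|_] := boolP (differ b y \subset J); last by rewrite mul0r.
  rewrite ffunE in yxj.
  have jJ : j \in J.
    apply: contraR yxj => jJ; have jx := contra (subsetP xJ j) jJ.
    have jy := contra (subsetP yJ j) jJ.
    move: jx jy ba; rewrite !inE !negbK => /eqP -> /eqP ->.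
    by case: (Z2P a) (Z2P b) => -> [->|->].
  rewrite (bigD1 j) //= (_ : qubit_kernel _ _ _ _ _ _ _ = 0) ?mul0r ?mulr0 //.
  move: yxj ba; rewrite /qubit_kernel.
  case: (Z2P (mux mu j)) (Z2P (x j)) (Z2P (y j)) (Z2P a) (Z2P b)
    => -> [->|->] [->|->] [->|->] [->|->] //=;
    by rewrite mul0r.
have -> : differ b (flip x) = differ a x.
  apply/setP=> j; rewrite !inE !ffunE; move: ba.
  by case: (Z2P (x j)) (Z2P a) (Z2P b) => -> [->|->] [->|->].
rewrite andbb mul1r; congr (_ * _).
have [Z0|/set0Pn[j]] := eqVneq (zset mu) set0; last first.
  rewrite in_zset => /andP[jJ mj]; rewrite mul0r.
  by rewrite (bigD1 j jJ) /qubit_kernel mj (negPf ba) !andbF /= mul0r.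
rewrite mul1r -prodr_const [LHS]big_mkcond [RHS]big_mkcond; apply: eq_bigr => j _.
have: j \notin zset mu by rewrite Z0 inE.
rewrite in_zset !inE ffunE /qubit_kernel; move: ba.
case: (Z2P (mux mu j)) (Z2P (muz mu j)) (Z2P (x j)) (Z2P a) (Z2P b)
  => -> [->|->] [->|->] [->|->] [->|->] //= _ _;
  by rewrite ?mul1r ?expr0 ?expr1.
Qed.

Lemma test_op_entry x y : qentry (test_op C mu) x y =
  \sum_a (differ a x \subset J)%:R *
    ((y == x)%:R * ((zset mu :&: differ a x == set0)%:R *
                    (if zset mu == set0 then 2^-1 else 1)) +
     (y == flip x)%:R * ((zset mu == set0)%:R / 2 * (-1) ^+ #|yset mu :&: differ a x|)).
Proof.
rewrite test_op_kernel mulr_sumr; apply: eq_bigr => a _.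
rewrite (bigD1 a) //= (bigD1 (a + 1)) /=; last by case: (Z2P a) => ->.
rewrite [X in _ * (_ + (_ + X))]big1 ?addr0 => [|b];
  last by case: (Z2P a) (Z2P b) => -> [->|->].
rewrite prod_kernel_same prod_kernel_diff; last by case: (Z2P a) => ->.
by rewrite /coef; case: (zset mu == set0) => /=; field.
Qed.

End TestOpEntries.

(** * Spectrum of the strategies *)

Section FlipBanded.
Variables (C : numClosedFieldType) (n : nat) (j0 : 'I_n) (d o : bits 'I_n -> C).
Variable A : qop C 'I_n.
Hypothesis AE : forall x y,
  qentry A x y = (y == x)%:R * d x + (y == flip x)%:R * o x.
Hypothesis dflip : forall x, d (flip x) = d x.
Hypothesis oflip : forall x, o (flip x) = o x.

Let sg (x : bits 'I_n) : C := (-1) ^+ x j0.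

(** The sign of column [x] depends on the bit at [j0], so the columns of [x] and of its complement
    carry the two opposite signs and are independent. *)
Definition flip_basis : qop C 'I_n :=
  mkqop (fun y x => (y == x)%:R + sg x * (y == flip x)%:R).

Lemma flip_neq (x : bits 'I_n) : (flip x == x) = false.
Proof.
by apply/eqP=> /ffunP/(_ j0); rewrite ffunE; case: (Z2P (x j0)) => ->.
Qed.

Lemma neq_flip (x : bits 'I_n) : (x == flip x) = false.
Proof. by rewrite eq_sym flip_neq. Qed.

Lemma sum_eq_flip (F : bits 'I_n -> C) (a b : C) x :
  \sum_z ((z == x)%:R * a + (z == flip x)%:R * b) * F z = a * F x + b * F (flip x).
Proof.
rewrite (bigD1 x) //= (bigD1 (flip x)) ?flip_neq //= big1 ?addr0.
  by rewrite !eqxx neq_flip /=; ring.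
by move=> z /andP[/negPf -> /negPf ->]; rewrite !mul0r addr0 mul0r.
Qed.

Lemma sg_flip x : sg (flip x) = - sg x.
Proof.
by rewrite /sg ffunE; case: (Z2P (x j0)) => ->; rewrite /= ?expr0 ?expr1 ?opprK.
Qed.

Lemma sg_sqr x : sg x * sg x = 1.
Proof. by rewrite /sg -expr2 sqrr_sign. Qed.

Lemma banded_mul_vec (u : qvec C 'I_n) x :
  (A *m u) (enum_rank x) 0 = d x * u (enum_rank x) 0 + o x * u (enum_rank (flip x)) 0.
Proof.
rewrite mxE sum_bits -(sum_eq_flip (fun z => u (enum_rank z) 0)).
by apply: eq_bigr => z _; rewrite -AE.
Qed.

Lemma flip_basis_flip y x : qentry flip_basis (flip y) x = sg x * qentry flip_basis y x.
Proof.
rewrite !qentry_mkqop (inj_eq (inv_inj (@flipK _))) (can2_eq (@flipK _) (@flipK _)).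
by rewrite mulrDr mulrA sg_sqr mul1r addrC.
Qed.

Let ev x := d x + sg x * o x.

Lemma flip_basis_eigen :
  A *m flip_basis = flip_basis *m diag_mx (\row_i ev (enum_val i)).
Proof.
apply: qentryP => y x; rewrite qentry_mul.
under eq_bigr => z _ do rewrite AE.
rewrite (sum_eq_flip (fun z => qentry flip_basis z x)) flip_basis_flip.
rewrite /qentry mul_mx_diag !mxE enum_rankK -/(qentry _ _ _).
rewrite !enum_rankK /ev.
have [->|_] := eqVneq y x; first by rewrite neq_flip /=; ring.
have [->|_] := eqVneq y (flip x); last by rewrite !(mulr0, addr0, mul0r).
by rewrite dflip oflip; ring.
Qed.

(** The columns are real and orthogonal with squared norm 2. *)
Lemma flip_basis_unit : flip_basis \in unitmx.
Proof.
suff : (2^-1 *: flip_basis^T) *m flip_basis = 1%:M by case/mulmx1_unit.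
apply: qentryP => x x'; rewrite qentry_mul qentry1.
transitivity (2^-1 * \sum_z ((z == x)%:R * 1 + (z == flip x)%:R * sg x) * qentry flip_basis z x').
  rewrite mulr_sumr; apply: eq_bigr => z _; rewrite qentryZ -mulrA; congr (_ * (_ * _)).
  by rewrite /qentry mxE -/(qentry _ _ _) qentry_mkqop mulr1 mulrC.
rewrite sum_eq_flip flip_basis_flip qentry_mkqop.
have [->|_] := eqVneq x x'.
  rewrite neq_flip /= mulr0 addr0 !mulr1 sg_sqr.
  by field.
have [->|_] := eqVneq x (flip x'); last by rewrite !(mulr0, addr0).
have := sg_sqr x'; rewrite sg_flip add0r mulr1 mul1r => H.
by rewrite mulNr mulrA H mul1r subrr mulr0.
Qed.

Lemma banded_char_poly : char_poly A = \prod_x ('X - (ev x)%:P).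
Proof.
pose L : qop C 'I_n := diag_mx (\row_i ev (enum_val i)).
have dP0 : \det (map_mx polyC flip_basis) != 0.
  by rewrite det_map_mx polyC_eq0 -unitfE -unitmxE flip_basis_unit.
have -> : char_poly A = char_poly L.
  (* Similarity is used in the form A P = P L, after multiplication by the nonzero determinant of
     P. *)
  apply: (mulIf dP0); rewrite [RHS]mulrC /char_poly -!det_mulmx; congr (\det _).
  rewrite /char_poly_mx mulmxBl mulmxBr -!map_mxM flip_basis_eigen -/L.
  by rewrite scalar_mxC.
rewrite char_poly_trig ?diag_mx_is_trig // (reindex (@enum_rank {: bits 'I_n})) /=.
  by apply: eq_bigr => x _; rewrite /L !mxE eqxx mulr1n enum_rankK.
by exists enum_val => x _; rewrite ?enum_rankK ?enum_valK.
Qed.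

(** The generator X...X, with sign -1, makes [psi] odd under complement, and the generators Z_1 Z_a,
    with sign +1, confine it to the constant strings; there the operator acts as d - o. *)
Lemma banded_stabilizer (psi : qvec C 'I_n) (l : C) :
  j0 = 0 :> nat -> is_stabilizer_state (w10 n) psi ->
  (forall a, d (cst _ a) - o (cst _ a) = l) ->
  A *m psi = l *: psi.
Proof.
move=> j00 [_ gen] dol; apply/matrixP=> i k.
rewrite ord1 -(enum_valK i) banded_mul_vec [RHS]mxE.
set x := enum_val i.
have psiflip : psi (enum_rank (flip x)) 0 = - psi (enum_rank x) 0.
  have /matrixP/(_ (enum_rank x) 0) := gen j0.
  rewrite /ghz_gen j00 eqxx tens_mulE (bigD1 (flip x)) //= [X in _ + X]big1 ?addr0.
    rewrite big1 => [|j _]; last by rewrite mxE ffunE Z2_neq eqxx.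
    by rewrite mul1r !mxE j00 eqxx expr1 mulN1r.
  move=> y /bits_neq[j yj]; rewrite (bigD1 j) //= mxE Z2_neq.
  by move: yj; rewrite ffunE => /negPf ->; rewrite !mul0r.
have [/existsP[a /eqP xa]|/existsPn nc] := boolP [exists a, x == cst _ a].
  by rewrite psiflip -(dol a) -xa; ring.
rewrite psiflip (_ : psi _ _ = 0) ?oppr0 ?mulr0 ?addr0 //.
have [j xj] : exists j, x j != x j0.
  have /bits_neq[j] := nc (x j0); rewrite ffunE; by exists j.
have j_neq0 : (j == 0 :> nat) = false.
  by apply/negP=> /eqP j0'; case/eqP: xj; congr (x _); apply: val_inj; rewrite /= j00.
have /matrixP/(_ (enum_rank x) 0) := gen j.
rewrite /ghz_gen j_neq0 tens_mulE (bigD1 x) //= [X in _ + X]big1 ?addr0; last first.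
  move=> y /bits_neq[k' yk]; rewrite (bigD1 k') //=.
  by case: ifP => _; rewrite mxE eq_sym (negPf yk) !mul0r.
have -> : \prod_(i < n) (if (i == 0 :> nat) || (i == j) then pauliZ C else 1%:M)
     (x i) (x i) = -1 :> C.
  rewrite (bigD1 j0) //= (bigD1 j) /=; last by apply: contra xj => /eqP ->.
  rewrite big1 => [|i' /andP[i0 ij]]; last first.
    by rewrite -(inj_eq val_inj) /= j00 in i0; rewrite (negPf i0) (negPf ij) mxE eqxx.
  rewrite j00 !eqxx orbT !mxE !eqxx mulr1; move: xj.
  case: (Z2P (x j)) (Z2P (x j0)) => -> [->|->] //= _; by rewrite ?expr0 ?expr1 ?mulr1 ?mul1r.
rewrite !mxE j_neq0 expr0 mul1r mulN1r => /eqP.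
by rewrite eqNr => /eqP.
Qed.

End FlipBanded.

(** * From symplectic vectors to labelings *)

Section SumOverSymplectic.
Variables (R : realFieldType) (n : nat).

Definition symp_of (M Y Z : {set 'I_n}) : symp n :=
  row_mx (\row_j (j \in M :\: Z)%:R) (\row_j (j \in Y :|: Z)%:R).

Lemma zset_sub_measured (mu : symp n) : zset mu \subset measured mu.
Proof.
by apply/subsetP=> j; rewrite !inE xpair_eqE => /andP[_ /eqP ->]; rewrite andbF.
Qed.

Lemma yset_sub_measured (mu : symp n) : yset mu \subset measured mu :\: zset mu.
Proof. by apply/subsetP=> j; rewrite !inE xpair_eqE => /andP[/eqP -> /eqP ->]. Qed.

Lemma sum_measured M (F : {set 'I_n} -> {set 'I_n} -> R) :
  \sum_(mu : symp n | measured mu == M) F (yset mu) (zset mu) = label_sum M F.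
Proof.
have muxE Y Z j : mux (symp_of M Y Z) j = (j \in M :\: Z)%:R.
  by rewrite /mux row_mxKl mxE.
have muzE Y Z j : muz (symp_of M Y Z) j = (j \in Y :|: Z)%:R.
  by rewrite /muz row_mxKr mxE.
have subYZ (M' Y Z : {set 'I_n}) j : Z \subset M' -> Y \subset M' :\: Z ->
    ((j \in Z) ==> (j \in M')) && ((j \in Y) ==> (j \notin Z) && (j \in M')).
  move=> ZM YM; apply/andP; split; apply/implyP; first exact: (subsetP ZM).
  by move/(subsetP YM); rewrite in_setD.
rewrite /label_sum pair_big_dep /=.
rewrite (reindex_onto (fun mu => (zset mu, yset mu)) (fun p => symp_of M p.2 p.1)) /=.
  apply: eq_bigl => mu; apply/eqP/andP => [<-|[/andP[ZM YM] /eqP <-]].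
    rewrite zset_sub_measured yset_sub_measured; split=> //; apply/eqP/rowP=> j.
    have [k ->|k ->] := split_ordP j; rewrite /symp_of ?(row_mxEl, row_mxEr) mxE.
      have -> : mu 0 (lshift n k) = mux mu k by rewrite /mux mxE.
      rewrite !inE xpair_eqE.
      by case: (Z2P (mux mu k)) => ->; case: (Z2P (muz mu k)) => ->.
    have -> : mu 0 (rshift n k) = muz mu k by rewrite /muz mxE.
    rewrite !inE.
    by case: (Z2P (mux mu k)) => ->; case: (Z2P (muz mu k)) => ->.
  apply/setP=> j; rewrite [LHS]inE muxE muzE xpair_eqE in_setD in_setU.
  move: (subYZ _ _ _ j ZM YM).
  by case: (j \in yset mu); case: (j \in zset mu); case: (j \in M).
case=> Z Y /= /andP[ZM YM]; congr (_, _); apply/setP=> j;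
  rewrite [LHS]inE muxE muzE in_setD in_setU; move: (subYZ _ _ _ j ZM YM);
  by case: (j \in Y); case: (j \in Z); case: (j \in M).
Qed.

Lemma sum_symp_wt t (F : {set 'I_n} -> {set 'I_n} -> {set 'I_n} -> R) :
  \sum_(mu in symp_wt n t) F (measured mu) (yset mu) (zset mu) =
  \sum_(M : {set 'I_n} | #|M| == t) label_sum M (F M).
Proof.
rewrite (partition_big (@measured n) (fun M => #|M| == t)) => [|mu]; last by rewrite inE.
apply: eq_bigr => M /eqP Mt; rewrite -sum_measured; apply: eq_big => mu.
  rewrite inE /weight; case: (eqVneq (measured mu) M) => [->|]; last by rewrite andbF.
  by rewrite Mt eqxx.
by case/andP=> _ /eqP ->.
Qed.

End SumOverSymplectic.

(** * Spectrum of a strategy whose weights depend only on the label counts *)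

Section WeightedStrategy.
Variables (R : realType) (n t : nat).
Hypothesis t_lt_n : (t < n)%N.
Variables (k : R) (W : nat -> nat -> R) (tot noZ : R).
Hypotheses (k_ge0 : 0 <= k) (k_tot : k * 'C(n, t)%:R * tot = 1).
Hypothesis noZ_bounds : 0 <= noZ <= tot.
Hypothesis sum_tot : forall M : {set 'I_n}, #|M| = t ->
  label_sum M (fun Y Z => W #|Y| #|Z|) = tot.
Hypothesis sum_noZ : forall M : {set 'I_n}, #|M| = t ->
  \sum_(Y : {set 'I_n} | Y \subset M) W #|Y| 0 = noZ.
Hypothesis eig_le : forall (M D : {set 'I_n}) (e : R), #|M| = t ->
  D \subset M -> D != set0 -> `|e| = 1 ->
  label_sum M (fun Y Z => label_eig D e Y Z * W #|Y| #|Z|) <= tot - noZ.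

(** A common form of both strategies. For each measured set the labelings weigh [tot] and those
    without Z weigh [noZ]; [k_tot] says that all the weights sum to 1. *)
Definition weighted_strategy : qop R[i] 'I_n :=
  \sum_(mu in symp_wt n t) (k * W #|yset mu| #|zset mu|)%:C%C *: test_op R[i] mu.

Let diag_part (D Y Z : {set 'I_n}) : R :=
  (Z :&: D == set0)%:R * (if Z == set0 then 2^-1 else 1).
Let flip_part (D Y Z : {set 'I_n}) : R :=
  (Z == set0)%:R / 2 * (-1) ^+ #|Y :&: D|.

Let total (part : {set 'I_n} -> {set 'I_n} -> {set 'I_n} -> R) (x : bits 'I_n) : R :=
  \sum_(mu in symp_wt n t) (k * W #|yset mu| #|zset mu|) *
    \sum_a (differ a x \subset measured mu)%:R * part (differ a x) (yset mu) (zset mu).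

Lemma unmeasured_wt (mu : symp n) : mu \in symp_wt n t -> (0 < #|~: measured mu|)%N.
Proof.
rewrite inE => /eqP wt; rewrite cardsCs setCK card_ord subn_gt0.
by rewrite -[#|_|]/(weight mu) wt.
Qed.

Lemma weighted_strategy_entry x y : qentry weighted_strategy x y =
  (y == x)%:R * (total diag_part x)%:C%C + (y == flip x)%:R * (total flip_part x)%:C%C.
Proof.
rewrite qentry_sum /total !rmorph_sum !mulr_sumr -big_split.
apply: eq_bigr => mu /unmeasured_wt um.
rewrite qentryZ test_op_entry // !(rmorphM _ (k * _)) !rmorph_sum /=.
rewrite mulrCA [X in _ + X]mulrCA -mulrDr.
congr (_ * _); rewrite !mulr_sumr -big_split; apply: eq_bigr => a _.
rewrite /diag_part /flip_part !rmorphM !rmorph_nat rmorphXn rmorphN1 fmorphV rmorph_nat.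
rewrite mulrDr; congr (_ + _); first
  by case: ifP => _; rewrite ?fmorphV ?rmorph_nat ?rmorph1; ring.
by ring.
Qed.

Lemma differ_flip a x : differ a (flip x) = differ (a + 1) x :> {set 'I_n}.
Proof.
apply/setP=> j; rewrite !inE ffunE.
by case: (Z2P (x j)) (Z2P a) => -> [->|->].
Qed.

Lemma total_flip part x : total part (flip x) = total part x.
Proof.
apply: eq_bigr => mu _; congr (_ * _); rewrite !sum_Z2 !differ_flip addrC.
by congr (_ + _); rewrite ?add0r // (_ : 1 + 1 = 0) //; apply: val_inj.
Qed.

Let eig (e : R) x := total diag_part x + e * total flip_part x.

Lemma eigE e x : eig e x = k * \sum_(M : {set 'I_n} | #|M| == t) \sum_a
  (differ a x \subset M)%:R *
    label_sum M (fun Y Z => label_eig (differ a x) e Y Z * W #|Y| #|Z|).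
Proof.
transitivity (\sum_(M : {set 'I_n} | #|M| == t) label_sum M (fun Y Z =>
   k * \sum_a (differ a x \subset M)%:R * (label_eig (differ a x) e Y Z * W #|Y| #|Z|))).
  rewrite -(sum_symp_wt t (fun M Y Z => k * \sum_a (differ a x \subset M)%:R *
      (label_eig (differ a x) e Y Z * W #|Y| #|Z|))).
  rewrite /eig /total mulr_sumr -big_split; apply: eq_bigr => mu _ /=.
  rewrite !sum_Z2 /label_eig /diag_part /flip_part.
  have regroup (c w s0 s1 d0 d1 f0 f1 : R) :
      c * w * (s0 * d0 + s1 * d1) + e * (c * w * (s0 * f0 + s1 * f1)) =
      c * (s0 * ((d0 + e * f0) * w) + s1 * ((d1 + e * f1) * w)) by ring.
  exact: regroup.
rewrite mulr_sumr; apply: eq_bigr => M _; rewrite label_sumZ; congr (_ * _).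
by rewrite sum_Z2 -!label_sumZ -label_sumD; apply: eq_label_sum => Y Z _ _; rewrite sum_Z2.
Qed.

(** Since t < n some qubit lies outside [M], and its bit equals both a and b. So each [M]
    contributes to an eigenvalue through at most one a. *)
Lemma differ_subset_inj (M : {set 'I_n}) a b x : #|M| = t ->
  differ a x \subset M -> differ b x \subset M -> a = b.
Proof.
move=> Mt aM bM; have [j jM] : exists j, j \notin M.
  apply/existsP; rewrite -negb_forall; apply: contraTN t_lt_n => /forallP all_in.
  by rewrite -Mt -leqNgt -[X in (X <= _)%N]card_ord subset_leq_card //; apply/subsetP.
have := contra (subsetP aM j) jM; have := contra (subsetP bM j) jM.
by rewrite !inE !negbK => /eqP <- /eqP <-.
Qed.

Lemma sum_draws (c : R) : k * \sum_(M : {set 'I_n} | #|M| == t) c = k * 'C(n, t)%:R * c.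
Proof.
rewrite (eq_bigl (fun M => M \in [set M : {set 'I_n} | #|M| == t])) => [|M];
    last by rewrite inE.
by rewrite sumr_const card_draws card_ord -[c *+ _]mulr_natl mulrA.
Qed.

Lemma eig_const e a : eig e (cst _ a) = 1 - k * 'C(n, t)%:R * ((1 - e) / 2 * noZ).
Proof.
rewrite -[X in _ = X - _]k_tot -mulrBr -sum_draws eigE; congr (_ * _).
apply: eq_bigr => M /eqP Mt.
have d0 : differ a (cst 'I_n a) = set0 by apply/setP=> j; rewrite !inE ffunE eqxx.
rewrite (bigD1 a) //= d0 sub0set mul1r label_eig_set0 sum_tot // sum_noZ //.
rewrite big1 ?addr0 // => b ba; have [bM|_] := boolP (_ \subset M); last by rewrite mul0r.
by case/eqP: ba; apply: (differ_subset_inj Mt bM); rewrite d0 sub0set.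
Qed.

(** For nonconstant [x] the differing set is nonempty for both a, so each [M] contributes 0 or a
    term bounded by [eig_le]; [noZ_bounds] covers the first case. *)
Lemma eig_le_second e x : `|e| = 1 -> (forall a, x != cst _ a) ->
  eig e x <= 1 - k * 'C(n, t)%:R * noZ.
Proof.
move=> e1 xa; rewrite -[X in _ <= X - _]k_tot -mulrBr -sum_draws eigE; apply: ler_wpM2l => //.
apply: ler_sum => M /eqP Mt.
have D0 a : differ a x != set0.
  have /bits_neq[j] := xa a; rewrite ffunE => xj.
  by apply/set0Pn; exists j; rewrite inE.
have bnd a : differ a x \subset M ->
    label_sum M (fun Y Z => label_eig (differ a x) e Y Z * W #|Y| #|Z|) <= tot - noZ.
  by move=> aM; apply: eig_le.
have dn : 0 <= tot - noZ by case/andP: noZ_bounds => _; rewrite subr_ge0.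
have [aM|aM] := boolP [exists a, differ a x \subset M]; last first.
  rewrite big1 // => a _; move/existsPn/(_ a)/negPf: aM => ->.
  by rewrite mul0r.
case/existsP: aM => a aM; rewrite (bigD1 a) //= aM mul1r big1 ?addr0 ?bnd // => b ba.
have [bM|_] := boolP (_ \subset M); last by rewrite mul0r.
by case/eqP: ba; apply: (differ_subset_inj Mt bM aM).
Qed.

Lemma weighted_strategy_spectrum : exists s : seq R,
  [/\ ordered_spectrum weighted_strategy s, s`_0 = 1, s`_1 = 1 - noZ / tot
    & forall psi : qvec R[i] 'I_n, is_stabilizer_state (w10 n) psi ->
        weighted_strategy *m psi = (s`_1)%:C%C *: psi].
Proof.
have n_gt0 : (0 < n)%N by apply: leq_ltn_trans t_lt_n.
pose j0 : 'I_n := Ordinal n_gt0.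
have tot0 : tot != 0.
  apply/eqP=> t0; move: k_tot; rewrite t0 mulr0 => /eqP.
  by rewrite eq_sym oner_eq0.
have noZ_tot : k * 'C(n, t)%:R * noZ = noZ / tot.
  by apply: (mulIf tot0); rewrite mulrAC k_tot mul1r divfK.
pose ev x := eig ((-1) ^+ (x : bits 'I_n) j0) x.
pose l2 := 1 - noZ / tot.
have c01 : cst 'I_n 1 != cst _ 0 by apply/eqP=> /ffunP/(_ j0); rewrite !ffunE.
have ev0 : ev (cst _ 0) = 1.
  by rewrite /ev eig_const ffunE expr0 subrr !mul0r mulr0 subr0.
have ev1 : ev (cst _ 1) = l2.
  rewrite /ev eig_const ffunE expr1 opprK -[1 + 1]/(2) divff ?pnatr_eq0 //.
  by rewrite mul1r noZ_tot.
pose other (x : bits 'I_n) := (x != cst _ 0) && (x != cst _ 1).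
have ev_le x : other x -> ev x <= l2.
  case/andP=> x0 x1; rewrite /l2 -noZ_tot; apply: eig_le_second.
    by rewrite normrX normrN1 expr1n.
  by move=> a; case: (Z2P a) => ->.
pose rest := [seq ev x | x <- enum {: bits 'I_n} & other x].
(* The string 0...0 has sign + and gives 1, the string 1...1 has sign - and gives [l2], and all the
   other strings stay below [l2]. *)
exists (1 :: l2 :: sort >=%R rest); split=> //.
  split.
    rewrite (banded_char_poly j0 weighted_strategy_entry); first last.
    - by move=> x; rewrite total_flip.
    - by move=> x; rewrite total_flip.
    rewrite !big_cons (perm_big _ (permEl (perm_sort _ _))) big_map big_filter big_enum_cond.
    rewrite [LHS](bigD1 (cst 'I_n 0)) //= [X in _ * X = _](bigD1 (cst 'I_n 1)) //=.
    have evE x : (total diag_part x)%:C%C +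
        (-1) ^+ (x : bits 'I_n) j0 * (total flip_part x)%:C%C
        = (ev x)%:C%C.
      by rewrite /ev /eig rmorphD rmorphM rmorphXn rmorphN1.
    rewrite !evE ev0 ev1; congr (_ * (_ * _)); apply: eq_bigr => x _.
    by rewrite evE.
  rewrite /= path_sortedE; last exact: ge_trans.
  rewrite sort_sorted ?andbT; last by move=> a b; rewrite le_total.
  apply/andP; split.
    by case/andP: noZ_bounds => p0 p1; rewrite /l2 lerBlDr lerDl divr_ge0 // (le_trans p0).
  apply/allP=> a; rewrite mem_sort => /mapP[x].
  by rewrite mem_filter => /andP[ox _] ->; apply: ev_le.
move=> psi stab; apply: (banded_stabilizer weighted_strategy_entry (j0 := j0) _ stab) => // a.
have := eig_const (-1) a; rewrite /eig mulN1r => H.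
rewrite -rmorphB H opprK -[1 + 1]/(2) divff ?pnatr_eq0 //.
by rewrite mul1r noZ_tot.
Qed.

End WeightedStrategy.

(** * Permutation classes of symplectic vectors *)

Section Classes.
Variable n : nat.
Implicit Types (mu : symp n) (s : 'S_n).

Lemma mux_perm s mu j : mux (qubit_perm s mu) j = mux mu (s j).
Proof. by rewrite /mux /qubit_perm row_mxKl mxE. Qed.

Lemma muz_perm s mu j : muz (qubit_perm s mu) j = muz mu (s j).
Proof. by rewrite /muz /qubit_perm row_mxKr mxE. Qed.

Lemma symp_eq mu mu' :
  (forall j, (mux mu j, muz mu j) = (mux mu' j, muz mu' j)) -> mu = mu'.
Proof.
move=> E; apply/rowP=> j; have [k ->|k ->] := split_ordP j.
  by have [] := E k; rewrite /mux !mxE.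
by have [_] := E k; rewrite /muz !mxE.
Qed.

Definition label_counts mu := (#|measured mu|, #|yset mu|, #|zset mu|).

Lemma card_label mu (v : 'Z_2 * 'Z_2) :
  #|[set j | (mux mu j, muz mu j) == v]| =
  if v.1 == 0 then if v.2 == 0 then (n - #|measured mu|)%N else #|zset mu|
  else if v.2 == 0 then (#|measured mu| - #|zset mu| - #|yset mu|)%N else #|yset mu|.
Proof.
have MZ : #|measured mu :\: zset mu| = (#|measured mu| - #|zset mu|)%N.
  by rewrite cardsD (setIidPr (zset_sub_measured mu)).
have MZY : #|(measured mu :\: zset mu) :\: yset mu| =
    (#|measured mu| - #|zset mu| - #|yset mu|)%N.
  by rewrite cardsD (setIidPr (yset_sub_measured mu)) MZ.
have M0 : #|~: measured mu| = (n - #|measured mu|)%N by rewrite cardsCs setCK card_ord.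
case: v => v1 v2 /=; rewrite -MZY -M0.
by case: (Z2P v1) (Z2P v2) => -> [->|->] /=; congr #|pred_of_set _|;
  apply/setP=> j; rewrite !inE !xpair_eqE;
  case: (Z2P (mux mu j)) (Z2P (muz mu j)) => -> [->|->].
Qed.

(** Permutations preserve the counts. Conversely, equal counts fix the multiplicity of all four
    labels by [card_label], so the label tuples are permutations of each other. *)
Lemma mem_symp_class mu mu' :
  (mu' \in symp_class mu) = (label_counts mu' == label_counts mu).
Proof.
apply/imsetP/eqP => [[s _ ->]|E].
  have preim (A B : {set 'I_n}) : (forall j, (j \in A) = (s j \in B)) -> #|A| = #|B|.
    move=> AB; rewrite -(card_preimset B (@perm_inj _ s)).
    by apply: eq_card => j; rewrite inE AB.
  by congr (_, _, _); apply: preim => j; rewrite !inE mux_perm muz_perm.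
pose lab m := [tuple (mux m j, muz m j) | j < n].
have /tuple_permP[s Es] : perm_eq (lab mu') (lab mu).
  apply/allP=> v _ /=; apply/eqP.
  have cnt m : count_mem v (lab m) = #|[set j | (mux m j, muz m j) == v]|.
    rewrite -sum1_count big_map big_enum_cond /= -sum1_card.
    by apply: eq_bigl => j; rewrite inE.
  by rewrite !cnt !card_label; case: E => -> -> ->.
exists s => //; apply: symp_eq => j; rewrite mux_perm muz_perm.
have := congr1 (fun u => nth (0, 0) u j) Es.
by rewrite -!tnth_nth !tnth_mktuple.
Qed.

(** Choose the measured set, then the Z-set inside it, then the Y-set inside the rest. *)
Lemma card_symp_class (R : realFieldType) mu :
  #|symp_class mu|%:R =
  'C(n, #|measured mu|)%:R / class_weight R #|measured mu| #|yset mu| #|zset mu| :> R.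
Proof.
set t := #|measured mu|; set b := #|yset mu|; set c := #|zset mu|.
have draws (N : {set 'I_n}) m :
    \sum_(Y : {set 'I_n} | Y \subset N) (#|Y| == m)%:R = 'C(#|N|, m)%:R :> R.
  rewrite -cards_draws -sum1_card natr_sum [RHS]big_mkcond [LHS]big_mkcond.
  by apply: eq_bigr => Y _; rewrite inE; case: (Y \subset N); case: (#|Y| == m).
transitivity (\sum_(mu' in symp_wt n t) (#|zset mu'| == c)%:R * (#|yset mu'| == b)%:R : R).
  rewrite -sum1_card natr_sum [LHS]big_mkcond [RHS]big_mkcond /=; apply: eq_bigr => mu' _.
  rewrite mem_symp_class !xpair_eqE inE /weight -/t -/b -/c.
  by case: (_ == t); case: (_ == b); case: (_ == c); rewrite ?mul0r ?mul1r.
rewrite (sum_symp_wt t (fun _ Y Z => (#|Z| == c)%:R * (#|Y| == b)%:R)).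
rewrite (eq_bigr (fun _ => ('C(t, c) * 'C(t - c, b))%:R)) => [|M /eqP Mt].
  rewrite (eq_bigl (fun M => M \in [set M : {set 'I_n} | #|M| == t])) => [|M];
    last by rewrite inE.
  by rewrite sumr_const card_draws card_ord /class_weight invrK -[_ *+ 'C(n, t)]mulr_natl.
rewrite /label_sum natrM -{1}Mt -draws mulr_suml; apply: eq_bigr => Z ZM.
rewrite -mulr_sumr draws cardsD (setIidPr ZM) Mt.
by case: eqP => [->|_]; rewrite ?mul0r.
Qed.

Lemma sum_symp_classes (V : nmodType) t (F : symp n -> {set symp n} -> V) :
  \sum_(c in symp_classes n t) \sum_(mu in c) F mu c =
  \sum_(mu in symp_wt n t) F mu (symp_class mu).
Proof.
rewrite [RHS](partition_big (@symp_class n) (fun c => c \in symp_classes n t)); last first.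
  by move=> mu mut; apply: imset_f.
apply: eq_bigr => c /imsetP[mu0 mu0t ->].
have cls mu : (mu \in symp_class mu0) = (symp_class mu == symp_class mu0).
  apply/idP/eqP => [|<-]; last by rewrite mem_symp_class.
  by rewrite mem_symp_class => /eqP E; apply/setP=> m; rewrite !mem_symp_class E.
apply: eq_big => [mu|mu]; last by rewrite cls => /eqP ->.
rewrite -cls andb_idl // mem_symp_class => /eqP[E _ _].
by move: mu0t; rewrite !inE /weight E.
Qed.

End Classes.

Theorem theoremV2 (R : realType) (n r : nat) (hr1 : (1 <= r)%N)
    (hrn : (r <= n - 1)%N) :
  (exists s : seq R,
    [/\ ordered_spectrum (strategy_uniform R[i] n (n - r)) s,
        s`_0 = 1,
        s`_1 = 1 - (2 / 3) ^+ (n - r),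
        forall psi : qvec R[i] 'I_n, is_stabilizer_state (w10 n) psi ->
          strategy_uniform R[i] n (n - r) *m psi = (s`_1)%:C%C *: psi
      & 1 - s`_1 = (2 / 3) ^+ (n - r)])
  /\
  (exists s : seq R,
    [/\ ordered_spectrum (strategy_classes R[i] n (n - r)) s,
        s`_0 = 1,
        s`_1 = (n - r)%:R / (n - r + 2)%:R,
        forall psi : qvec R[i] 'I_n, is_stabilizer_state (w10 n) psi ->
          strategy_classes R[i] n (n - r) *m psi = (s`_1)%:C%C *: psi
      & 1 - s`_1 = 2 / (n - r + 2)%:R]).
Proof.
have t_gt0 : (0 < n - r)%N by lia.
have t_lt_n : (n - r < n)%N by lia.
move: (n - r)%N t_gt0 t_lt_n => t t_gt0 t_lt_n {r hr1 hrn}.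
have Cnt0 : 'C(n, t)%:R != 0 :> R by rewrite pnatr_eq0 -lt0n bin_gt0 ltnW.
split.
  have X0 : (3 : R) ^+ t != 0 by rewrite expf_neq0 // pnatr_eq0.
  have sumC (M : {set 'I_n}) : #|M| = t -> label_sum M (fun _ _ => 1 : R) = 3 ^+ t.
    by move=> <-; apply: label_sum_const.
  have noZ (M : {set 'I_n}) : #|M| = t ->
      \sum_(Y : {set 'I_n} | Y \subset M) 1 = 2 ^+ t :> R.
    move=> <-; rewrite (_ : 2 = 1 + 1) -?sum_pow_subset; last by lra.
    by apply: eq_bigr => Y _; rewrite expr1n.
  (* Case (i) has constant weight 1: a measured set has 3^t labelings, of which 2^t avoid Z. *)
  have [s [sp s0 s1 eig]] := @weighted_strategy_spectrum R n t t_lt_n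
    (('C(n, t) * 3 ^ t)%:R^-1) (fun _ _ => 1) (3 ^+ t) (2 ^+ t)
    ltac:(by rewrite invr_ge0 ler0n)
    ltac:(by rewrite natrM natrX; field; rewrite Cnt0 X0)
    ltac:(by rewrite exprn_ge0 //= lerXn2r ?nnegrE ?ler_nat)
    sumC noZ
    ltac:(by move=> M D e Mt DM D0 _; rewrite -Mt; apply: label_eig_const_le; rewrite ?Mt).
  have strat : strategy_uniform R[i] n t =
      weighted_strategy n t (('C(n, t) * 3 ^ t)%:R^-1 : R) (fun _ _ => 1).
    rewrite /strategy_uniform /weighted_strategy scaler_sumr; apply: eq_bigr => mu _.
    by rewrite mulr1 fmorphV rmorph_nat.
  have E : s`_1 = 1 - (2 / 3) ^+ t by rewrite s1 expr_div_n.
  by exists s; rewrite strat; split=> //; rewrite E opprB addrCA subrr addr0.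
have p1 : t%:R + 1 != 0 :> R by rewrite natr1 pnatr_eq0.
have p2 : t%:R + 2 != 0 :> R by rewrite -natrD addn2 pnatr_eq0.
have sumC (M : {set 'I_n}) : #|M| = t ->
    label_sum M (fun Y Z => class_weight R t #|Y| #|Z|) = ((t + 1) * (t + 2))%:R / 2.
  by move=> <-; apply: label_sum_class_weight.
have noZ (M : {set 'I_n}) : #|M| = t ->
    \sum_(Y : {set 'I_n} | Y \subset M) class_weight R t #|Y| 0 = t.+1%:R.
  by move=> <-; apply: sum_class_weight0.
(* A class has C(n,t) / [class_weight] elements, so dividing by its size leaves [class_weight] and
   moves C(n,t) into [k]. *)
pose k : R := 2 / ((t + 1) * (t + 2))%:R / 'C(n, t)%:R.
have [s [sp s0 s1 eig]] := @weighted_strategy_spectrum R n t t_lt_n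
    k (class_weight R t) (((t + 1) * (t + 2))%:R / 2) t.+1%:R
    ltac:(by rewrite !divr_ge0)
    ltac:(by rewrite /k natrM !natrD; field; rewrite ?p1 ?p2 ?Cnt0)
    ltac:(by rewrite ler0n /= ler_pdivlMr // -natrM ler_nat; nia)
    sumC noZ
    ltac:(by move=> M D e Mt DM D0 e1; rewrite -Mt; apply: label_eig_class_le; rewrite ?Mt).
have strat : strategy_classes R[i] n t = weighted_strategy n t k (class_weight R t).
  rewrite /strategy_classes /weighted_strategy.
  under eq_bigr => c _ do rewrite scaler_sumr.
  rewrite (sum_symp_classes t (fun mu c => #|c|%:R^-1 *: test_op R[i] mu)) scaler_sumr.
  apply: eq_bigr => mu; rewrite inE => /eqP wt; rewrite scalerA; congr (_ *: _).
  have -> : #|symp_class mu|%:R = (#|symp_class mu|%:R : R)%:C%C by rewrite rmorph_nat.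
  rewrite -fmorphV card_symp_class -/(weight mu) wt invf_div /k.
  move: (class_weight _ _ _ _) ((t + 1) * (t + 2))%N => w N.
  by rewrite !rmorphM !fmorphV !rmorph_nat mulrA mulrAC.
(* The ratio of t + 1 to (t + 1)(t + 2) / 2 is 2 / (t + 2). *)
have E : s`_1 = t%:R / (t + 2)%:R.
  by rewrite s1 -[t.+1]addn1 natrM !natrD; field; rewrite ?p1 ?p2.
exists s; rewrite strat; split=> //; rewrite E natrD; field; by rewrite ?p2.
Qed.
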